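(* Let $k\ge 2$ be an integer. The vertex operator algebra $N_0$ is generated by $\omega$ and $W^3$. Consequently $N_0$ equals the subalgebra generated by $\omega, W^3, W^4, W^5$ for any $W^4,W^5\in N_0$ (in particular it coincides with the $W$-algebra $W(2,3,4,5)$ realized inside $N_0$).
   Context: Let $\{h,e,f\}$ be the standard basis of $sl_2$ ($[h,e]=2e$, $[h,f]=-2f$, $[e,f]=h$), with normalized form $\langle h,h\rangle=2$, $\langle e,f\rangle=1$, other pairings zero. $a(n)$ denotes the action of $a\otimes t^n\in\widehat{sl}_2$, with $[a(m),b(n)]=[a,b](m+n)+m\langle a,b\rangle\delta_{m+n,0}k$. $V(k,0)$ is the level $k$ induced (Weyl) module of $\widehat{sl}_2$ generated by $\mathbb{1}$ with $a(n)\mathbb{1}=0$ for $n\ge0$; it is a vertex operator algebra with $Y(a(-1)\mathbb{1},z)=\sum_n a(n)z^{-n-1}$. Define $N_0=\{v\in V(k,0)\mid h(m)v=0 \text{ for all } m\ge 0\}$; this is the commutant in $V(k,0)$ of the Heisenberg vertex subalgebra spanned by the vectors $h(-i_1)\cdots h(-i_p)\mathbb{1}$, and it is a vertex operator algebra with Virasoro vector $\omega=\frac{1}{2k(k+2)}\big(-kh(-2)\mathbb{1}-h(-1)^2\mathbb{1}+2k\,e(-1)f(-1)\mathbb{1}\big)$ of central charge $2(k-1)/(k+2)$. Define $W^3=k^2h(-3)\mathbb{1}+3kh(-2)h(-1)\mathbb{1}+2h(-1)^3\mathbb{1}-6k\,h(-1)e(-1)f(-1)\mathbb{1}+3k^2e(-2)f(-1)\mathbb{1}-3k^2e(-1)f(-2)\mathbb{1}\in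 N_0$ (a Virasoro primary vector of weight $3$). ''Generated'' means the smallest vertex subalgebra containing the given vectors. *)

(* Defs.v *)
From HB Require Import structures.
From mathcomp Require Import all_boot all_order all_algebra.
Set Implicit Arguments. Unset Strict Implicit. Unset Printing Implicit Defensive.
Import Order.TTheory GRing.Theory Num.Theory.
Local Open Scope ring_scope.

Inductive sl2 := Hb | Eb | Fb.
Definition sl2_eqb (x y : sl2) : bool :=
  match x, y with Hb, Hb | Eb, Eb | Fb, Fb => true | _, _ => false end.
Lemma sl2_eqP : Equality.axiom sl2_eqb.
Proof. by case; case; constructor. Qed.
HB.instance Definition _ := hasDecEq.Build sl2 sl2_eqP.

(* A letter (x, a) stands for the operator x(-(a+1)) = x (x) t^(-(a+1)).
   A word [:: l1; ...; lr] stands for the vector l1 ... lr 1 of V(k,0). *)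
Definition letter := (sl2 * nat)%type.
Definition word := seq letter.

Definition wt (w : word) : nat := sumn [seq l.2.+1 | l <- w].

Section Weyl.
Variable F : fieldType.
Variable k : F.

Definition vec := seq (F * word).

Definition coef (v : vec) (w : word) : F := \sum_(p <- v | p.2 == w) p.1.
Definition scalev (c : F) (v : vec) : vec := [seq (c * p.1, p.2) | p <- v].
Definition linv (f : word -> vec) (v : vec) : vec :=
  flatten [seq scalev p.1 (f p.2) | p <- v].

Definition br (x y : sl2) : seq (F * sl2) :=
  match x, y with
  | Hb, Eb => [:: (2%:R, Eb)]
  | Hb, Fb => [:: (- 2%:R, Fb)]
  | Eb, Fb => [:: (1, Hb)]
  | Eb, Hb => [:: (- 2%:R, Eb)]
  | Fb, Hb => [:: (2%:R, Fb)]
  | Fb, Eb => [:: (-1, Hb)]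
  | _, _ => [::]
  end.

Definition form (x y : sl2) : F :=
  match x, y with
  | Hb, Hb => 2%:R
  | Eb, Fb | Fb, Eb => 1
  | _, _ => 0
  end.

Fixpoint act (x : sl2) (n : int) (v : word) {struct v} : vec :=
  if n < 0 then [:: (1, (x, (`|n|%N).-1) :: v)]
  else match v with
  | [::] => [::]
  | (y, a) :: w =>
      [seq (p.1, (y, a) :: p.2) | p <- act x n w]
      ++ flatten [seq scalev cz.1 (act cz.2 (n - (a.+1)%:Z) w) | cz <- br x y]
      ++ (if n == (a.+1)%:Z then [:: (n%:~R * form x y * k, w)] else [::])
  end.

(* The two-sided ideal of the tensor algebra on the letters generated by
   the relations x(-p) y(-q) - y(-q) x(-p) - [x,y](-p-q); the quotient is
   U(t^-1 sl2[t^-1]) = V(k,0).  [ideal v] means v represents 0 in V(k,0). *)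
Definition relator (u t : word) (x : sl2) (a : nat) (y : sl2) (b : nat) : vec :=
  [:: (1, u ++ (x, a) :: (y, b) :: t); (-1, u ++ (y, b) :: (x, a) :: t)]
  ++ [seq (- cz.1, u ++ (cz.2, (a + b).+1) :: t) | cz <- br x y].

Inductive ideal : vec -> Prop :=
| ideal_zero v : (forall w, coef v w = 0) -> ideal v
| ideal_rel u t x a y b : ideal (relator u t x a y b)
| ideal_add v1 v2 : ideal v1 -> ideal v2 -> ideal (v1 ++ v2)
| ideal_scale c v : ideal v -> ideal (scalev c v)
| ideal_coef v1 v2 : (forall w, coef v1 w = coef v2 w) -> ideal v1 -> ideal v2.

Definition veq (v1 v2 : vec) : Prop := ideal (v1 ++ scalev (-1) v2).

Definition vac : vec := [:: (1, [::])].

(* n-th product u_n v for words u, v, via the iterate formula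
   (a_p b)_n = sum_{j>=0} (-1)^j binom(p,j) (a_{p-j} b_{n+j} - (-1)^p b_{p+n-j} a_j)
   with a = x(-1)1, p = -(a+1); (-1)^j binom(-m,j) = binom(m+j-1,j).
   The sums are truncated at a bound beyond which all terms vanish. *)
Fixpoint prodw (u : word) (n : int) (v : word) {struct u} : vec :=
  match u with
  | [::] => if n == -1 then [:: (1, v)] else [::]
  | (x, a) :: w =>
      flatten [seq scalev ('C(a + j, j))%:R
                 (linv (act x (- (a + 1 + j)%N%:Z)) (prodw w (n + j%:Z) v)
                  ++ scalev (- (-1) ^+ a.+1)
                       (linv (prodw w (n - (a + 1 + j)%N%:Z)) (act x j%:Z v)))
              | j <- iota 0 (wt u + wt v + `|n|).+1]
  end.

Definition nprod (u : vec) (n : int) (v : vec) : vec :=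
  flatten [seq flatten [seq scalev (p.1 * q.1) (prodw p.2 n q.2) | q <- v]
          | p <- u].

Definition N0 (v : vec) : Prop := forall m : nat, veq (linv (act Hb m%:Z) v) [::].

Definition vsubalg (P : vec -> Prop) : Prop :=
  [/\ P vac,
      (forall v1 v2, P v1 -> P v2 -> P (v1 ++ v2)),
      (forall c v, P v -> P (scalev c v)),
      (forall u v (n : int), P u -> P v -> P (nprod u n v))
    & (forall v1 v2, veq v1 v2 -> P v1 -> P v2)].

Definition generated (S : seq vec) (v : vec) : Prop :=
  forall P, vsubalg P -> (forall s, s \in S -> P s) -> P v.

Definition omega : vec :=
  scalev (2%:R * k * (k + 2%:R))^-1
    [:: (- k, [:: (Hb, 1%N)]);
        (-1, [:: (Hb, 0%N); (Hb, 0%N)]);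
        (2%:R * k, [:: (Eb, 0%N); (Fb, 0%N)])].

Definition W3 : vec :=
  [:: (k ^+ 2, [:: (Hb, 2%N)]);
      (3%:R * k, [:: (Hb, 1%N); (Hb, 0%N)]);
      (2%:R, [:: (Hb, 0%N); (Hb, 0%N); (Hb, 0%N)]);
      (- (6%:R * k), [:: (Hb, 0%N); (Eb, 0%N); (Fb, 0%N)]);
      (3%:R * k ^+ 2, [:: (Eb, 1%N); (Fb, 0%N)]);
      (- (3%:R * k ^+ 2), [:: (Eb, 0%N); (Fb, 1%N)])].

End Weyl.

(* Main.v *)
(* Write x_n for the modes of x in sl2 and Y(u)_n for the n-th products.  The
   fields carry operators x(p) given by the iterate formula; for p < 0 they
   satisfy the same commutation relations as the letters of a word, so that Y
   factors through V(k,0).  Comparing [x_l, Y(u)_n] with Y(x(q)u), q >= 0, and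
   using locality, h_l commutes with Y(u)_n for all integers l as soon as
   h(q)u = 0 for all q >= 0; hence N_0 is a vertex subalgebra.

   Let N be the subalgebra generated by omega and W^3, and G the span of the
   vectors h(-i1) ... h(-ip) w with w in N.  Then G is closed under all n-th
   products.  It contains e(-1)f(-1)1 (from omega) and e(-2)f(-1)1 (from W^3),
   and modulo lower weights and derivatives
     (e(-2)f(-1)1)_1 e(-a)f(-1)1 = (a+2)(ka+a+1) e(-a-1)f(-1)1,
   so G contains all e(-s)f(-t)1.  By induction on the length of words these
   vectors and the h(-i) produce all words of charge 0, that is, the kernel of
   h(0).  Finally, the operator sum_i h(-i)h(i)/(2ik) acts on G with eigenvalue
   p on h(-i1) ... h(-ip) w, so a vector of G killed by all h(m), m > 0, lies
   in N. *)
Require Import Defs.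
From HB Require Import structures.
From mathcomp Require Import all_boot all_order all_algebra.
From mathcomp Require Import boolp.
From mathcomp Require Import zify ring.
Set Implicit Arguments. Unset Strict Implicit. Unset Printing Implicit Defensive.
Import Order.TTheory GRing.Theory Num.Theory.
Local Open Scope ring_scope.
Local Open Scope quotient_scope.


(** * Linear identities in left modules, by reflection *)

Section LinearCombinations.
Variables (F : fieldType) (V : lmodType F).

(** No PBW basis is used: V(k,0) enters only as the span of words modulo relators, so each operator
    on it is built on words and shown to kill the relators. This includes the fields Y(u), and it is
    done without the full Jacobi identity; commutators with a current suffice. They are kept as
    double families of modes on which multiplication by z1 - z2 acts. A family killed by a power of
    z1 - z2 is recovered from the rows l = 0 of its successive multiples, and for [x_l, Y(u)_n]
    these rows are the fields of x(q)u. The detour through G is forced: e(-1)f(-1)1 is not killed by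
    h(1), so an induction on words cannot stay inside N. The level enters through divisions.
    Recovering e(-1)f(-1)1 from omega needs k and k + 2 to be nonzero, the degree operator needs k,
    and the recursion for e(-s)f(-1)1 divides by k(a+2) + a + 3, which vanishes at certain negative
    rational levels but at no positive integer in characteristic 0. *)

Inductive lexpr :=
| LZero | LAtom of nat | LAdd of lexpr & lexpr | LOpp of lexpr
| LScale of F & lexpr.

Fixpoint leval (env : seq V) (e : lexpr) : V :=
  match e with
  | LZero => 0
  | LAtom i => nth 0 env i
  | LAdd a b => leval env a + leval env b
  | LOpp a => - leval env a
  | LScale c a => c *: leval env a
  end.

Fixpoint ladd (s t : seq F) : seq F :=
  match s, t with
  | [::], _ => t
  | _, [::] => s
  | a :: s', b :: t' => (a + b) :: ladd s' t'
  end.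

Fixpoint lnorm (e : lexpr) : seq F :=
  match e with
  | LZero => [::]
  | LAtom i => ncons i 0 [:: 1]
  | LAdd a b => ladd (lnorm a) (lnorm b)
  | LOpp a => map (fun x => - x) (lnorm a)
  | LScale c a => map (fun x => c * x) (lnorm a)
  end.

Fixpoint lcomb (env : seq V) (s : seq F) : V :=
  match s, env with
  | c :: s', v :: env' => c *: v + lcomb env' s'
  | _, _ => 0
  end.

Fixpoint lzero (t : seq F) : Prop :=
  if t is b :: t' then 0 = b /\ lzero t' else True.

Fixpoint leqs (s t : seq F) : Prop :=
  match s, t with
  | [::], _ => lzero t
  | a :: s', [::] => a = 0 /\ leqs s' [::]
  | a :: s', b :: t' => a = b /\ leqs s' t'
  end.

Lemma lcomb_nil env : lcomb env [::] = 0. Proof. by case: env. Qed.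

Lemma lcomb_add env s t : lcomb env (ladd s t) = lcomb env s + lcomb env t.
Proof.
elim: s env t => [|a s IH] [|v env] [|b t] //=; rewrite ?add0r ?addr0 //.
by rewrite IH scalerDl addrACA.
Qed.

Lemma lcomb_scale env (c : F) s :
  lcomb env [seq c * x | x <- s] = c *: lcomb env s.
Proof.
elim: s env => [|a s IH] [|v env] //=; rewrite ?scaler0 //.
by rewrite IH scalerDr scalerA.
Qed.

Lemma lcomb_opp env s : lcomb env [seq - x | x <- s] = - lcomb env s.
Proof.
elim: s env => [|a s IH] [|v env] //=; rewrite ?oppr0 //.
by rewrite IH opprD scaleNr.
Qed.

Lemma lcomb_atom env i : lcomb env (ncons i 0 [:: 1]) = nth 0 env i.
Proof.
elim: i env => [|i IH] [|v env] //=; first by rewrite lcomb_nil scale1r addr0.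
by rewrite IH scale0r add0r.
Qed.

Lemma levalE env e : leval env e = lcomb env (lnorm e).
Proof.
elim: e => /= [|i|a -> b ->|a ->|c a ->].
- by rewrite lcomb_nil.
- by rewrite lcomb_atom.
- by rewrite lcomb_add.
- by rewrite lcomb_opp.
- by rewrite lcomb_scale.
Qed.

Lemma leqs_lcomb env s t : leqs s t -> lcomb env s = lcomb env t.
Proof.
elim: s t env => [|a s IH] t env.
  elim: t env => [|b t IHt] [|v env] //= [<- Ht].
  by rewrite scale0r add0r -IHt ?lcomb_nil.
case: t env => [|b t] [|v env] //= [-> /IH ->] //.
by rewrite scale0r add0r lcomb_nil.
Qed.

(** Only soundness is needed: the atoms may be linearly dependent, and equal coefficients still
    suffice. Each atom leaves one scalar equation for [ring]. *)
Lemma leval_eq env e1 e2 : leqs (lnorm e1) (lnorm e2) ->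
  leval env e1 = leval env e2.
Proof. by rewrite !levalE; apply: leqs_lcomb. Qed.

End LinearCombinations.

(* Up to conversion: equal integer arguments may be built along different
   canonical instances. *)
Ltac l_index x env :=
  match env with
  | ?y :: _ => let _ := match goal with _ => unify x y end in constr:(0%N)
  | _ :: ?env' => let i := l_index x env' in constr:(S i)
  end.

Ltac l_atoms e env :=
  match e with
  | @GRing.zero _ => env
  | @GRing.add _ ?a ?b => let env1 := l_atoms a env in l_atoms b env1
  | @GRing.opp _ ?a => l_atoms a env
  | @GRing.scale _ _ ?c ?a => l_atoms a env
  | _ => match env with
         | _ => let i := l_index e env in env
         | _ => constr:(e :: env)
         end
  end.

Ltac l_reify F e env :=
  match e with
  | @GRing.zero _ => constr:(@LZero F)
  | @GRing.add _ ?a ?b =>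
      let a' := l_reify F a env in let b' := l_reify F b env in
      constr:(@LAdd F a' b')
  | @GRing.opp _ ?a => let a' := l_reify F a env in constr:(@LOpp F a')
  | @GRing.scale _ _ ?c ?a =>
      let a' := l_reify F a env in constr:(@LScale F c a')
  | _ => let i := l_index e env in constr:(@LAtom F i)
  end.

Ltac lmod_coefs F :=
  lazymatch goal with
  | |- @eq ?T ?a ?b =>
      let env0 := constr:(@nil T) in
      let env1 := l_atoms a env0 in
      let env := l_atoms b env1 in
      let a' := l_reify F a env in
      let b' := l_reify F b env in
      refine (@leval_eq F _ env a' b' _);
      cbn [lnorm ladd map ncons ssrnat.iter leqs lzero seq.map seq.ncons]; repeat split
  end.
Ltac lmod F := lmod_coefs F; try ring.

(** * Linear extension of maps on words *)

Section LinearExtension.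
Variables (F : fieldType) (V : lmodType F).
Implicit Types (f : word -> V) (v : vec F).

Definition lext f v : V := \sum_(p <- v) p.1 *: f p.2.

Lemma lext_cat f v1 v2 : lext f (v1 ++ v2) = lext f v1 + lext f v2.
Proof. by rewrite /lext big_cat. Qed.

Lemma lext_nil f : lext f [::] = 0. Proof. by rewrite /lext big_nil. Qed.

Lemma lext_cons f p v : lext f (p :: v) = p.1 *: f p.2 + lext f v.
Proof. by rewrite /lext big_cons. Qed.

Lemma lext_scalev f c v : lext f (scalev c v) = c *: lext f v.
Proof.
rewrite /lext /scalev big_map scaler_sumr.
by apply: eq_bigr => p _; rewrite scalerA.
Qed.

Lemma lext_flatten f (I : Type) (s : seq I) (g : I -> vec F) :
  lext f (flatten [seq g i | i <- s]) = \sum_(i <- s) lext f (g i).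
Proof.
elim: s => [|i s IH] /=; first by rewrite big_nil lext_nil.
by rewrite big_cons lext_cat IH.
Qed.

Lemma lext_linv f (g : word -> vec F) v :
  lext f (linv g v) = lext (fun w => lext f (g w)) v.
Proof.
rewrite /linv lext_flatten [RHS]/lext; apply: eq_bigr => p _.
by rewrite lext_scalev.
Qed.

Lemma eq_lext f g v : f =1 g -> lext f v = lext g v.
Proof. by move=> E; apply: eq_bigr => p _; rewrite E. Qed.

Lemma lextD f g v : lext (fun w => f w + g w) v = lext f v + lext g v.
Proof. by rewrite /lext -big_split; apply: eq_bigr => p _; rewrite scalerDr. Qed.

Lemma lextZ c f v : lext (fun w => c *: f w) v = c *: lext f v.
Proof.
rewrite /lext scaler_sumr; apply: eq_bigr => p _.
by rewrite !scalerA mulrC.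
Qed.

Lemma lext_coefE f v (s : seq word) : uniq s ->
  {subset [seq p.2 | p <- v] <= s} ->
  lext f v = \sum_(w <- s) coef v w *: f w.
Proof.
move=> Us; elim: v => [|p v IH] Hs.
  rewrite lext_nil big1 // => w _; by rewrite /coef big_nil scale0r.
rewrite lext_cons IH; last by move=> w Hw; apply: Hs; rewrite inE Hw orbT.
have Hp : p.2 \in s by apply: Hs; rewrite inE eqxx.
rewrite [RHS](bigD1_seq p.2) //= [in LHS](bigD1_seq p.2) //=.
rewrite addrA /coef !big_cons eqxx -scalerDl; congr (_ + _).
apply: eq_bigr => w Hw; rewrite big_cons eq_sym.
by rewrite (negbTE Hw).
Qed.

(** A [vec] is a list with possible repetitions; regrouping over a common duplicate-free list of
    words shows that only coefficients count. *)
Lemma lext_coef f v1 v2 : (forall w, coef v1 w = coef v2 w) ->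
  lext f v1 = lext f v2.
Proof.
move=> E.
pose s := undup ([seq p.2 | p <- v1] ++ [seq p.2 | p <- v2]).
rewrite (@lext_coefE _ _ s) ?undup_uniq //; last first.
  by move=> w Hw; rewrite mem_undup mem_cat Hw.
rewrite (@lext_coefE _ _ s) ?undup_uniq //; last first.
  by move=> w Hw; rewrite mem_undup mem_cat Hw orbT.
by apply: eq_bigr => w _; rewrite E.
Qed.

(** The universal property of the quotient: this is the test by which every map out of V(k,0) is
    shown to be well defined. *)
Lemma lext_ideal f :
  (forall u t x a y b, lext f (relator F u t x a y b) = 0) ->
  forall v, ideal v -> lext f v = 0.
Proof.
move=> Hrel v; elim=> {v} [v Hv|u t x a y b|v1 v2 _ E1 _ E2|c v _ E|v1 v2 E _ <-].
- rewrite (@lext_coef f v [::]) ?lext_nil // => w.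
  by rewrite Hv /coef big_nil.
- exact: Hrel.
- by rewrite lext_cat E1 E2 addr0.
- by rewrite lext_scalev E scaler0.
- by apply: lext_coef => w; rewrite E.
Qed.

End LinearExtension.

Section Coef.
Variable F : fieldType.
Implicit Types v : vec F.

Lemma coef_cat v1 v2 w : coef (v1 ++ v2) w = coef v1 w + coef v2 w.
Proof. by rewrite /coef big_cat. Qed.

Lemma coef_scalev c v w : coef (scalev c v) w = c * coef v w.
Proof. by rewrite /coef /scalev big_map mulr_sumr. Qed.

Lemma coef_nil w : coef ([::] : vec F) w = 0.
Proof. by rewrite /coef big_nil. Qed.

End Coef.

Definition sl2_code (x : sl2) : option bool :=
  match x with Hb => None | Eb => Some true | Fb => Some false end.
Definition sl2_decode (o : option bool) : sl2 :=
  match o with None => Hb | Some true => Eb | Some false => Fb end.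
Lemma sl2_codeK : cancel sl2_code sl2_decode. Proof. by case. Qed.
HB.instance Definition _ := CanHasChoice sl2_codeK.


(** * The quotient by [ideal] and the action of affine sl2 *)

Section WeylModule.
Variables (F : fieldType).

Lemma veq_refl : reflexive (fun u v : vec F => `[< veq u v >]).
Proof.
move=> v; apply/asboolP; apply: ideal_zero => w.
by rewrite coef_cat coef_scalev mulN1r subrr.
Qed.

Lemma veq_sym : symmetric (fun u v : vec F => `[< veq u v >]).
Proof.
suff S (u v : vec F) : veq u v -> veq v u by move=> u v; apply/asboolP/asboolP; apply: S.
move=> H; refine (ideal_coef _ (ideal_scale (-1) H)) => w.
by rewrite !(coef_cat, coef_scalev); ring.
Qed.

Lemma veq_trans : transitive (fun u v : vec F => `[< veq u v >]).
Proof.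
move=> v u w /asboolP H1 /asboolP H2; apply/asboolP.
refine (ideal_coef _ (ideal_add H1 H2)) => t.
by rewrite !(coef_cat, coef_scalev); ring.
Qed.

Canonical veq_equiv := EquivRel _ veq_refl veq_sym veq_trans.

(* The ideal does not involve the level: only the action does. *)
Definition weyl := {eq_quot veq_equiv}.
HB.instance Definition _ := Choice.on weyl.
HB.instance Definition _ := EqQuotient.on weyl.

Definition cls (v : vec F) : weyl := \pi_weyl v.

Lemma clsP u v : cls u = cls v <-> veq u v.
Proof. by split=> [/eqmodP/asboolP|H] //; apply/eqmodP/asboolP. Qed.

Lemma cls_surj (x : weyl) : exists v, x = cls v.
Proof. by exists (repr x); rewrite /cls reprK. Qed.

Lemma veq_cat (u1 u2 v1 v2 : vec F) : veq u1 u2 -> veq v1 v2 -> veq (u1 ++ v1) (u2 ++ v2).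
Proof.
move=> H1 H2; refine (ideal_coef _ (ideal_add H1 H2)) => t.
by rewrite !(coef_cat, coef_scalev); ring.
Qed.

Lemma veq_scale c (u v : vec F) : veq u v -> veq (scalev c u) (scalev c v).
Proof.
move=> H; refine (ideal_coef _ (ideal_scale c H)) => t.
by rewrite !(coef_cat, coef_scalev); ring.
Qed.

Lemma veq_coef (u v : vec F) : (forall w, coef u w = coef v w) -> veq u v.
Proof.
by move=> H; apply: ideal_zero => w; rewrite coef_cat coef_scalev H; ring.
Qed.

Lemma cls_coef u v : (forall w, coef u w = coef v w) -> cls u = cls v.
Proof. by move/veq_coef/clsP. Qed.

Lemma veq_repr v : veq (repr (cls v)) v.
Proof. by apply/clsP; rewrite /cls reprK. Qed.

Definition weyl_add (x y : weyl) : weyl := cls (repr x ++ repr y).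
Definition weyl_scale (c : F) (x : weyl) : weyl := cls (scalev c (repr x)).
Definition weyl_opp := weyl_scale (-1).
Definition weyl_zero : weyl := cls [::].

Lemma weyl_addE u v : weyl_add (cls u) (cls v) = cls (u ++ v).
Proof. by apply/clsP/veq_cat; apply: veq_repr. Qed.
Lemma weyl_scaleE c u : weyl_scale c (cls u) = cls (scalev c u).
Proof. by apply/clsP/veq_scale/veq_repr. Qed.

Let coefE := (coef_cat, coef_scalev, coef_nil).

Lemma weyl_addA : associative weyl_add.
Proof.
move=> x y z; have [u ->] := cls_surj x; have [v ->] := cls_surj y.
by have [w ->] := cls_surj z; rewrite !weyl_addE catA.
Qed.
Lemma weyl_addC : commutative weyl_add.
Proof.
move=> x y; have [u ->] := cls_surj x; have [v ->] := cls_surj y.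
by rewrite !weyl_addE; apply: cls_coef => w; rewrite !coefE addrC.
Qed.
Lemma weyl_add0 : left_id weyl_zero weyl_add.
Proof. by move=> x; have [u ->] := cls_surj x; rewrite weyl_addE. Qed.
Lemma weyl_addN : left_inverse weyl_zero weyl_opp weyl_add.
Proof.
move=> x; have [u ->] := cls_surj x; rewrite /weyl_opp weyl_scaleE weyl_addE.
by apply: cls_coef => w; rewrite !coefE; ring.
Qed.

HB.instance Definition _ :=
  GRing.isZmodule.Build weyl weyl_addA weyl_addC weyl_add0 weyl_addN.

Lemma cls_cat u v : cls (u ++ v) = cls u + cls v.
Proof. by rewrite -weyl_addE. Qed.

Lemma weyl_scaleA a b x : weyl_scale a (weyl_scale b x) = weyl_scale (a * b) x.
Proof.
have [u ->] := cls_surj x; rewrite !weyl_scaleE.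
by apply: cls_coef => w; rewrite !coefE mulrA.
Qed.
Lemma weyl_scale1 : left_id 1 weyl_scale.
Proof.
move=> x; have [u ->] := cls_surj x; rewrite !weyl_scaleE.
by apply: cls_coef => w; rewrite !coefE mul1r.
Qed.
Lemma weyl_scaleDr : right_distributive weyl_scale +%R.
Proof.
move=> c x y; have [u ->] := cls_surj x; have [v ->] := cls_surj y.
rewrite -cls_cat !weyl_scaleE -cls_cat.
by apply: cls_coef => w; rewrite !coefE mulrDr.
Qed.
Lemma weyl_scaleDl v : {morph weyl_scale^~ v : a b / a + b}.
Proof.
move=> a b; have [u ->] := cls_surj v; rewrite !weyl_scaleE -cls_cat.
by apply: cls_coef => w; rewrite !coefE mulrDl.
Qed.

HB.instance Definition _ := GRing.Zmodule_isLmodule.Build F weyl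
  weyl_scaleA weyl_scale1 weyl_scaleDr weyl_scaleDl.

Lemma cls_scale c u : cls (scalev c u) = c *: cls u.
Proof. by rewrite -weyl_scaleE. Qed.
Lemma cls_nil : cls [::] = 0. Proof. by []. Qed.

Definition wcls (w : word) : weyl := cls [:: (1, w)].

Lemma cls_lext v : cls v = lext wcls v.
Proof.
elim: v => [|[c w] v IH]; first by rewrite lext_nil.
rewrite lext_cons -IH -cls_scale -cls_cat; apply: cls_coef => t.
by rewrite coef_cat coef_scalev /coef !big_cons !big_nil /=; case: ifP => _; ring.
Qed.

Lemma lext_cls (V : lmodType F) (f : word -> V) :
  (forall u t x a y b, lext f (relator F u t x a y b) = 0) ->
  forall u v, cls u = cls v -> lext f u = lext f v.
Proof.
move=> H u v /clsP /(lext_ideal H).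
by rewrite lext_cat lext_scalev scaleN1r => /subr0_eq.
Qed.

Section Factor.
Variables (V : lmodType F) (f : word -> V).
Hypothesis Hf : forall u t x a y b, lext f (relator F u t x a y b) = 0.

(** The proof that [f] kills relators is carried as an argument, so that the term itself determines
    the linear structure declared below. *)
Definition factor (_ : forall u t x a y b, lext f (relator F u t x a y b) = 0)
  (x : weyl) : V := lext f (repr x).

Lemma factorE v : factor Hf (cls v) = lext f v.
Proof. by apply: lext_cls => //; rewrite /cls reprK. Qed.

Lemma factor_linear : linear (factor Hf).
Proof.
move=> c x y; have [u ->] := cls_surj x; have [v ->] := cls_surj y.
by rewrite -cls_scale -cls_cat !factorE lext_cat lext_scalev.
Qed.
HB.instance Definition _ :=
  GRing.isLinear.Build F weyl V *:%R (factor Hf) factor_linear.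

Lemma factor_w w : factor Hf (wcls w) = f w.
Proof. by rewrite factorE lext_cons lext_nil addr0 scale1r. Qed.
End Factor.

Lemma lext_relator (V : lmodType F) (f : word -> V) u t x a y b :
  lext f (relator F u t x a y b) =
  f (u ++ (x, a) :: (y, b) :: t) - f (u ++ (y, b) :: (x, a) :: t)
  - \sum_(cz <- br F x y) cz.1 *: f (u ++ (cz.2, (a + b).+1) :: t).
Proof.
rewrite /relator !lext_cons /= scale1r scaleN1r addrA; congr (_ - _ + _).
rewrite /lext big_map -sumrN; apply: eq_bigr => cz _.
by rewrite scaleNr.
Qed.

Lemma wcls_relator u t x a y b : lext wcls (relator F u t x a y b) = 0.
Proof.
rewrite -cls_lext -[RHS]cls_nil; apply/clsP.
by rewrite /veq cats0; apply: ideal_rel.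
Qed.

Lemma cons_relator (l : letter) u t x a y b :
  lext (fun w => wcls (l :: w)) (relator F u t x a y b) = 0.
Proof. by have := wcls_relator (l :: u) t x a y b; rewrite !lext_relator. Qed.

Definition crea (l : letter) : weyl -> weyl := factor (cons_relator l).
HB.instance Definition _ l := GRing.Linear.on (crea l).

Lemma crea_w l w : crea l (wcls w) = wcls (l :: w).
Proof. exact: factor_w. Qed.

Lemma lext_crea l f v : lext (fun w => crea l (f w)) v = crea l (lext f v).
Proof.
by rewrite /lext linear_sum; apply: eq_bigr => p _; rewrite linearZ.
Qed.

Lemma lext_map_cons (g : word -> weyl) (l : letter) (v : vec F) :
  lext g [seq (p.1, l :: p.2) | p <- v] = lext (fun w => g (l :: w)) v.
Proof. by rewrite /lext big_map. Qed.

Variable k : F.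

Definition actw x n w : weyl := lext wcls (act k x n w).

Lemma actw_neg x n w : n < 0 -> actw x n w = crea (x, (`|n|%N).-1) (wcls w).
Proof.
by move=> Hn; rewrite /actw; case: w => [|l w] /=; rewrite Hn lext_cons
  lext_nil addr0 scale1r crea_w.
Qed.

(** For [n >= 0] this is the recursion of [act]. For [n < 0], where [act] just prepends a letter, it
    is the relator exchanging that letter with [(y, a)]. One formula thus serves all modes. *)
Lemma actw_cons x n y a w : actw x n ((y, a) :: w) =
  crea (y, a) (actw x n w)
  + \sum_(cz <- br F x y) cz.1 *: actw cz.2 (n - a.+1%:Z) w
  + (if n == a.+1%:Z then n%:~R * Defs.form F x y * k else 0) *: wcls w.
Proof.
have [Hn|Hn] := boolP (n < 0).
  rewrite (@actw_neg _ _ (_ :: _)) // (@actw_neg _ _ w) //.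
  rewrite (negbTE (_ : n != _)); last by lia.
  rewrite scale0r addr0 !crea_w.
  have := wcls_relator [::] w x (`|n|%N).-1 y a.
  rewrite lext_relator /= => /eqP; rewrite subr_eq0 subr_eq => /eqP ->.
  rewrite addrC; congr (_ + _); apply: eq_bigr => cz _; congr (_ *: _).
  rewrite actw_neg; last by lia.
  by rewrite crea_w; congr (wcls ((_, _) :: _)); lia.
rewrite {1}/actw /= (negbTE Hn) !lext_cat lext_map_cons addrA.
congr (_ + _ + _).
- by rewrite -lext_crea; apply: eq_lext => t; rewrite crea_w.
- by rewrite lext_flatten; apply: eq_bigr => cz _; rewrite lext_scalev.
- by case: ifP => _; rewrite ?lext_cons lext_nil ?addr0 // scale0r.
Qed.

End WeylModule.


(** * The action of affine sl2 at level k and its commutation relations *)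

Section AffineAction.
Variables (F : fieldType) (k : F).
Local Notation weyl := (weyl F).
Local Notation form := (Defs.form F).

Lemma weyl_ind (P : weyl -> Prop) :
  P 0 -> (forall c w v, P v -> P (c *: wcls F w + v)) -> forall v, P v.
Proof.
move=> P0 PS v; have [u ->] := cls_surj v; rewrite cls_lext.
by elim: u => [|[c w] u IH]; rewrite ?lext_nil // lext_cons; apply: PS.
Qed.

Lemma lext_sum (V : lmodType F) (I : Type) (s : seq I) (g : I -> word -> V)
    (v : vec F) :
  lext (fun w => \sum_(i <- s) g i w) v = \sum_(i <- s) lext (g i) v.
Proof.
rewrite /lext exchange_big /=; apply: eq_bigr => p _; exact: scaler_sumr.
Qed.

Lemma relator_cons l u t x a y b :
  relator F (l :: u) t x a y b =
  [seq (p.1, l :: p.2) | p <- relator F u t x a y b].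
Proof. by rewrite /relator map_cat -map_comp. Qed.

Lemma crea_comm x a y b (v : weyl) :
  crea (x, a) (crea (y, b) v) = crea (y, b) (crea (x, a) v)
  + \sum_(cz <- br F x y) cz.1 *: crea (cz.2, (a + b).+1) v.
Proof.
elim/weyl_ind: v => [|c w v IH].
  by rewrite !linear0 big1 ?addr0 // => cz _; rewrite linear0 scaler0.
rewrite !linearP /= {}IH.
under [in RHS]eq_bigr => cz _ do rewrite linearP scalerDr scalerA mulrC -scalerA.
rewrite big_split -scaler_sumr /= addrACA -scalerDr; congr (_ *: _ + _).
have := wcls_relator F [::] w x a y b.
rewrite lext_relator !crea_w /= => /eqP; rewrite subr_eq0 subr_eq => /eqP ->.
by rewrite addrC; congr (_ + _); apply: eq_bigr => cz _; rewrite crea_w.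
Qed.

Lemma creaD l (u v : weyl) : crea l (u + v) = crea l u + crea l v.
Proof. exact: linearD. Qed.
Lemma creaZ l c (u : weyl) : crea l (c *: u) = c *: crea l u.
Proof. exact: linearZ. Qed.
Lemma crea0 l : crea l (0 : weyl) = 0.
Proof. exact: linear0. Qed.

(** Expanding [x(n)] past the two letters in either order leaves the Jacobi identity of sl2 for the
    operators and the invariance of the form for the central terms, both checked on the 27 triples
    of basis vectors. *)
Lemma actw_relator_nil x n t y a z b : 0 <= n ->
  lext (actw k x n) (relator F [::] t y a z b) = 0.
Proof.
move=> Hn; rewrite lext_relator /=.
rewrite !actw_cons !creaD !creaZ.
rewrite (crea_comm y a z b) !crea_w.
have [m H5] : exists m, n - (a + b).+2%:Z = m by eexists.
have H1 : n - b.+1%:Z - a.+1%:Z = m by lia.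
have H2 : n - a.+1%:Z - b.+1%:Z = m by lia.
have H3 : (n - a.+1%:Z == b.+1%:Z) = (n == (a + b).+2%:Z) by lia.
have H4 : (n - b.+1%:Z == a.+1%:Z) = (n == (a + b).+2%:Z) by lia.
(* The double commutators have a central term only at [n = a + b + 2]; there [d1 + d2 = n] splits it
   into the contributions of the two orders. *)
pose d1 : F := if n == (a + b).+2%:Z then a.+1%:R else 0.
pose d2 : F := if n == (a + b).+2%:Z then b.+1%:R else 0.
have E1 f : (if n - a.+1%:Z == b.+1%:Z then (n - a.+1%:Z)%:~R * f * k else 0)
    = d2 * f * k.
  by rewrite H3 /d2; case: eqP => [->|_]; rewrite ?mul0r //; congr (_ * _ * _);
  rewrite -[RHS]/(b.+1%:Z%:~R); congr (_%:~R); lia.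
have E2 f : (if n - b.+1%:Z == a.+1%:Z then (n - b.+1%:Z)%:~R * f * k else 0)
    = d1 * f * k.
  by rewrite H4 /d1; case: eqP => [->|_]; rewrite ?mul0r //; congr (_ * _ * _);
  rewrite -[RHS]/(a.+1%:Z%:~R); congr (_%:~R); lia.
have E3 f : (if n == (a + b).+2%:Z then n%:~R * f * k else 0)
    = (d1 + d2) * f * k.
  rewrite /d1 /d2; case: eqP => [->|_]; rewrite ?addr0 ?mul0r //.
  by rewrite -natrD addSn addnS.
have E0 c f : (if n == c%:Z then n%:~R * f * k else 0)
    = (if n == c%:Z then n%:~R * k else 0) * f.
  by case: ifP => _; rewrite ?mul0r // mulrAC.
rewrite !E0; set c1 := (if n == a.+1%:Z then _ else 0).
set c2 := (if n == b.+1%:Z then _ else 0).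
case: x; case: y; case: z; rewrite /= ?big_cons ?big_nil /=.
all: rewrite ?actw_cons ?E1 ?E2 ?E3 /= ?big_cons ?big_nil /= ?crea_w ?H1 ?H2 ?H5.
all: rewrite ?creaD ?creaZ ?crea0 -?crea_w.
all: lmod F.
Qed.

Lemma actw_relator x n u t y a z b :
  lext (actw k x n) (relator F u t y a z b) = 0.
Proof.
elim: u x n => [|[l c] u IH] x n; have [Hn|Hn] := ltP n 0.
- under eq_lext => w do rewrite actw_neg //.
  by rewrite lext_crea wcls_relator crea0.
- exact: actw_relator_nil.
- under eq_lext => w do rewrite actw_neg //.
  by rewrite lext_crea wcls_relator crea0.
rewrite relator_cons lext_map_cons.
under eq_lext => w do rewrite actw_cons.
rewrite !lextD lext_sum lextZ wcls_relator scaler0 addr0 lext_crea IH crea0.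
by rewrite add0r big1 // => cz _; rewrite lextZ IH scaler0.
Qed.

(* Locked: unification would otherwise unfold [op] down to the quotient. *)
Fact op_key : unit. Proof. exact: tt. Qed.
Definition op x n : weyl -> weyl :=
  locked_with op_key (factor (actw_relator x n)).
Lemma op_linear x n : linear (op x n).
Proof. by rewrite /op unlock; apply: linearP. Qed.
HB.instance Definition _ x n :=
  GRing.isLinear.Build F weyl weyl *:%R (op x n) (op_linear x n).

Lemma opD x n u v : op x n (u + v) = op x n u + op x n v.
Proof. exact: linearD. Qed.
Lemma opN x n u : op x n (- u) = - op x n u.
Proof. exact: linearN. Qed.
Lemma opZ x n c v : op x n (c *: v) = c *: op x n v.
Proof. exact: linearZ. Qed.
Lemma op0 x n : op x n 0 = 0.
Proof. exact: linear0. Qed.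
Lemma op_sum x n (I : Type) (r : seq I) (P : pred I) (f : I -> weyl) :
  op x n (\sum_(i <- r | P i) f i) = \sum_(i <- r | P i) op x n (f i).
Proof. exact: linear_sum. Qed.

Lemma op_actw x n w : op x n (wcls F w) = actw k x n w.
Proof. by rewrite /op unlock factor_w. Qed.

Lemma op_w x n w : op x n (wcls F w) = cls (act k x n w).
Proof. by rewrite op_actw /actw cls_lext. Qed.

Lemma op_cls x n v : op x n (cls v) = cls (linv (act k x n) v).
Proof.
rewrite !cls_lext lext_linv /lext op_sum; apply: eq_bigr => p _.
by rewrite opZ op_w cls_lext.
Qed.

Definition vacuum : weyl := wcls F [::].

Lemma op_vacuum x n : 0 <= n -> op x n vacuum = 0.
Proof. by move=> Hn; rewrite op_w /= ltNge Hn /= cls_nil. Qed.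

Lemma op_crea x a v : op x (- a.+1%:Z) v = crea (x, a) v.
Proof.
elim/weyl_ind: v => [|c w v IH]; first by rewrite op0 crea0.
rewrite opD opZ IH creaD creaZ crea_w; congr (_ *: _ + _).
by rewrite op_w; congr cls; case: w => [|l w] /=.
Qed.

Lemma wcls_cons x a w : wcls F ((x, a) :: w) = op x (- a.+1%:Z) (wcls F w).
Proof. by rewrite op_crea crea_w. Qed.

Lemma weyl_spanned (P : weyl -> Prop) :
  P 0 -> (forall c v, P v -> P (c *: v)) -> (forall u v, P u -> P v -> P (u + v)) ->
  P vacuum -> (forall x a v, P v -> P (op x (- a.+1%:Z) v)) ->
  forall v, P v.
Proof.
move=> P0 PZ PD Pv Po; elim/weyl_ind => // c w v Hv; apply: PD => //; apply: PZ.
by elim: w => [|[x a] w IH] //; rewrite wcls_cons; apply: Po.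
Qed.

Definition central x y (m n : int) : F :=
  if m + n == 0 then m%:~R * form x y * k else 0.

Definition commutes x m y n v :=
  op x m (op y n v) = op y n (op x m v)
  + \sum_(cz <- br F x y) cz.1 *: op cz.2 (m + n) v + central x y m n *: v.

Lemma commutes_linear x m y n c u v :
  commutes x m y n u -> commutes x m y n v -> commutes x m y n (c *: u + v).
Proof.
rewrite /commutes => Hu Hv; rewrite !opD !opZ Hu Hv.
under [in RHS]eq_bigr => cz _ do
  rewrite opD opZ scalerDr scalerA mulrC -scalerA.
rewrite big_split -scaler_sumr /=.
set Su := \sum_(i <- _) i.1 *: op _ _ u; set Sv := \sum_(i <- _) i.1 *: op _ _ v.
lmod F.
Qed.

Lemma commutes0 x m y n : commutes x m y n 0.
Proof.
rewrite /commutes !op0 big1 ?scaler0 ?addr0 // => cz _.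
by rewrite op0 scaler0.
Qed.

Lemma op_comm_neg x m y a v : commutes x m y (- a.+1%:Z) v.
Proof.
elim/weyl_ind: v => [|c w v IH].
  exact: commutes0.
apply: commutes_linear IH; rewrite /commutes /central.
rewrite -wcls_cons !op_actw actw_cons -op_crea.
congr (_ + _ + _).
  by apply: eq_bigr => cz _; rewrite op_actw.
by rewrite subr_eq0; case: eqP => // ->.
Qed.

Lemma br_anti x y (g : sl2 -> weyl) :
  \sum_(cz <- br F y x) cz.1 *: g cz.2 = - \sum_(cz <- br F x y) cz.1 *: g cz.2.
Proof. by case: x; case: y; rewrite /= ?big_cons ?big_nil /=; lmod F. Qed.

Lemma central_anti x m y n : central y x n m = - central x y m n.
Proof.
rewrite /central [n + m]addrC; case: eqP => [E|_]; last by rewrite oppr0.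
have -> : n = - m by lia.
by rewrite rmorphN /=; case: x; case: y; rewrite /=; ring.
Qed.

Lemma commutes_sym x m y n v : commutes x m y n v -> commutes y n x m v.
Proof.
rewrite /commutes => ->; rewrite (br_anti x y (fun z => op z (n + m) v)).
rewrite [n + m]addrC; set S1 := \sum_(i <- _) _.
by rewrite central_anti; lmod F.
Qed.

(** If a mode is negative this is [op_comm_neg], up to antisymmetry. For two nonnegative modes both
    sides vanish on the vacuum, and moving both past one more letter reduces the claim to a shorter
    vector by the Jacobi identity. *)
Lemma op_comm x m y n v : commutes x m y n v.
Proof.
elim/weyl_spanned: v x m y n => [|c v IH|u v IHu IHv||z a v IH] x m y n.
- exact: commutes0.
- by rewrite -[c *: v]addr0; apply: commutes_linear => //; apply: commutes0.
- by rewrite -[u]scale1r; apply: commutes_linear.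
all: have [n0|n0] := ltP n 0; first by
  have -> : n = - (`|n|%N.-1).+1%:Z by [lia]; apply: op_comm_neg.
all: have [m0|m0] := ltP m 0; first by
  have -> : m = - (`|m|%N.-1).+1%:Z by [lia];
  apply/commutes_sym/op_comm_neg.
- rewrite /commutes !op_vacuum // !op0 big1 => [|cz _]; last first.
    by rewrite op_vacuum ?scaler0 // addr_ge0.
  rewrite /central; case: eqP => [E|_]; last by rewrite scale0r !addr0.
  have -> : m = 0 by lia.
  by rewrite mulr0z !mul0r scale0r !addr0.
have Cn w x' n' := op_comm_neg x' n' z a w.
rewrite /commutes in IH Cn *; rewrite !Cn !(opD, opZ, op_sum) !Cn IH.
have [p H0] : exists p, m + n = p by eexists.
have [q H4] : exists q, p - a.+1%:Z = q by eexists.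
have H1 : m + (n - a.+1%:Z) = q by lia.
have H2 : n + (m - a.+1%:Z) = q by lia.
have H3 : m - a.+1%:Z + n = q by lia.
pose dm : F := if q == 0 then m%:~R * k else 0.
pose dn : F := if q == 0 then n%:~R * k else 0.
have E1 w w' : central w w' m (n - a.+1%:Z) = dm * form w w'.
  by rewrite /central /dm H1; case: ifP => _; rewrite ?mul0r // mulrAC.
have E2 w w' : central w w' n (m - a.+1%:Z) = dn * form w w'.
  by rewrite /central /dn H2; case: ifP => _; rewrite ?mul0r // mulrAC.
have E3 w w' : central w w' p (- a.+1%:Z) = (dm + dn) * form w w'.
  rewrite /central /dm /dn H4; case: ifP => _; rewrite ?addr0 ?mul0r //.
  by rewrite -mulrDl -rmorphD /= H0 mulrAC.
have Ix w := IH x m w (n - a.+1%:Z).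
have Iy w := IH y n w (m - a.+1%:Z).
rewrite H0; clear IH.
move: Cn Ix Iy.
case: x; case: y; case: z; rewrite /= ?big_cons ?big_nil /= => Cn Ix Iy.
all: rewrite ?opD ?opZ ?op0 ?opN.
all: rewrite ?Ix ?Iy ?Cn ?E1 ?E2 ?E3 /= ?big_cons ?big_nil /= ?H1 ?H2 ?H3 ?H4 ?H0.
all: lmod F.
Qed.
End AffineAction.


(** * Locally finite sums and products of fields *)

Section LocallyFiniteSums.
Variables (F : fieldType) (V : lmodType F).
Implicit Types (f g : nat -> V).

Definition fsupp f := exists N, forall j, (N <= j)%N -> f j = 0.

(* Junk value 0 when f does not have finite support. *)
Definition lsum f : V :=
  if pselect (fsupp f) is left H then \sum_(j < projT1 (cid H)) f j else 0.

Lemma big_ord_fsupp f M N : (forall j, (N <= j)%N -> f j = 0) -> (N <= M)%N ->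
  \sum_(j < M) f j = \sum_(j < N) f j.
Proof.
move=> Hf HNM; rewrite -(subnKC HNM) big_split_ord /= [X in _ + X]big1 ?addr0 //.
by move=> i _; apply: Hf; apply: leq_addr.
Qed.

Lemma lsumE N f : (forall j, (N <= j)%N -> f j = 0) ->
  lsum f = \sum_(j < N) f j.
Proof.
move=> Hf; rewrite /lsum; case: pselect => [H|[]]; last by exists N.
case: cid => M /= HM.
rewrite -(@big_ord_fsupp f (maxn M N) M) ?leq_maxl //.
by rewrite (@big_ord_fsupp f (maxn M N) N) ?leq_maxr.
Qed.

Lemma eq_lsum f g : f =1 g -> lsum f = lsum g.
Proof. by move/funext=> ->. Qed.

Lemma fsuppD f g : fsupp f -> fsupp g -> fsupp (fun j => f j + g j).
Proof.
case=> N HN [M HM]; exists (maxn N M) => j; rewrite geq_max => /andP [/HN -> /HM ->].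
by rewrite addr0.
Qed.

Lemma fsuppZ (c : nat -> F) f : fsupp f -> fsupp (fun j => c j *: f j).
Proof. by case=> N HN; exists N => j /HN ->; rewrite scaler0. Qed.

Lemma lsumD f g : fsupp f -> fsupp g ->
  lsum (fun j => f j + g j) = lsum f + lsum g.
Proof.
case=> N HN [M HM].
have HN' j : (maxn N M <= j)%N -> f j = 0 by rewrite geq_max => /andP [/HN].
have HM' j : (maxn N M <= j)%N -> g j = 0 by rewrite geq_max => /andP [_ /HM].
rewrite (lsumE HN') (lsumE HM') (@lsumE (maxn N M)) ?big_split // => j Hj.
by rewrite HN' // HM' // addr0.
Qed.

Lemma lsum0 : lsum (fun=> 0) = 0.
Proof. by rewrite (@lsumE 0) ?big_ord0. Qed.

Lemma lsumZ c f : fsupp f -> lsum (fun j => c *: f j) = c *: lsum f.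
Proof.
case=> N HN; rewrite (lsumE HN) (@lsumE N) ?scaler_sumr // => j /HN ->.
by rewrite scaler0.
Qed.

Lemma linear_at0 (h : V -> V) : linear h -> h 0 = 0.
Proof. by move=> Hh; have := Hh (-1) 0 0; rewrite scaler0 addr0 scaleN1r addNr. Qed.

Lemma linear_lsum (h : V -> V) f : linear h -> fsupp f ->
  h (lsum f) = lsum (fun j => h (f j)).
Proof.
move=> Hh [N HN].
pose hl := GRing.isLinear.Build F V V *:%R h Hh.
pose H : {linear V -> V} := HB.pack h hl.
have -> : h = H by [].
rewrite (lsumE HN) (@lsumE N) ?linear_sum // => j /HN ->.
exact: linear0.
Qed.

Lemma lsum_recl f : fsupp f -> lsum f = f 0%N + lsum (fun j => f j.+1).
Proof.
case=> N HN; rewrite (@lsumE N.+1) => [|j /ltnW /HN] //.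
by rewrite big_ord_recl (@lsumE N) // => j Hj; apply: HN; apply: leqW.
Qed.

Lemma lsum1 i f : (forall j, j != i -> f j = 0) -> lsum f = f i.
Proof.
move=> Hf; rewrite (@lsumE i.+1) => [|j Hj]; last by apply: Hf; rewrite gtn_eqF.
rewrite big_ord_recr /= big1 ?add0r // => j _; apply: Hf.
by rewrite ltn_eqF.
Qed.

Definition dsupp (f : nat -> nat -> V) :=
  exists N, forall i j, (N <= i)%N || (N <= j)%N -> f i j = 0.
Definition dsum (f : nat -> nat -> V) := lsum (fun i => lsum (f i)).

Lemma dsumE N (f : nat -> nat -> V) :
  (forall i j, (N <= i)%N || (N <= j)%N -> f i j = 0) ->
  dsum f = \sum_(i < N) \sum_(j < N) f i j.
Proof.
move=> Hf; rewrite /dsum (@lsumE N).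
  by apply: eq_bigr => i _; apply: lsumE => j Hj; rewrite Hf // Hj orbT.
move=> i Hi; rewrite (@lsumE N) ?big1 // => [j _|j Hj]; by rewrite Hf // Hi.
Qed.

Lemma dsum_exchange (f : nat -> nat -> V) : dsupp f -> dsum f = dsum (fun i j => f j i).
Proof.
case=> N HN; rewrite (dsumE HN) (@dsumE N) => [|i j]; last by rewrite orbC => /HN.
exact: exchange_big.
Qed.

(* The coefficient of t^j in (1 - t)^(-p). *)
Definition ncoef (p j : nat) : nat := if p is a.+1 then 'C(a + j, j) else j == 0%N.

Lemma ncoef_0r p : ncoef p 0 = 1%N.
Proof. by case: p => [|p] //=; rewrite addn0 bin0. Qed.

Lemma ncoefSS p j : ncoef p.+1 j.+1 = (ncoef p j.+1 + ncoef p.+1 j)%N.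
Proof.
case: p => [|p] /=; first by rewrite !add0n !binn.
by rewrite addSn binS addSnnS.
Qed.

(** With S the shift of sequences, this is the value at 0 of [(1 - S)^(-p) f], which makes sense
    because a finitely supported [f] is killed by a power of S. *)
Definition csum p f := lsum (fun j => (ncoef p j)%:R *: f j).

Lemma eq_csum p f g : f =1 g -> csum p f = csum p g.
Proof. by move/funext=> ->. Qed.

Lemma csum0 f : csum 0 f = f 0%N.
Proof.
rewrite /csum (@lsum1 0) ?scale1r // => j /negbTE Hj.
by rewrite /= Hj scale0r.
Qed.

Lemma csum_zero p : csum p (fun=> 0) = 0.
Proof. by rewrite /csum -[RHS]lsum0; apply: eq_lsum => j; rewrite scaler0. Qed.

Lemma csumD p f g : fsupp f -> fsupp g ->
  csum p (fun j => f j + g j) = csum p f + csum p g.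
Proof.
move=> Hf Hg; rewrite /csum -lsumD; try exact: fsuppZ.
by apply: eq_lsum => j; rewrite scalerDr.
Qed.

Lemma csumZ p c f : fsupp f -> csum p (fun j => c *: f j) = c *: csum p f.
Proof.
move=> Hf; rewrite /csum -lsumZ; last exact: fsuppZ.
by apply: eq_lsum => j; rewrite !scalerA mulrC.
Qed.

Lemma csumB p f g : fsupp f -> fsupp g ->
  csum p (fun j => f j - g j) = csum p f - csum p g.
Proof.
move=> Hf Hg; rewrite -scaleN1r -csumZ // -csumD //; last exact: fsuppZ.
by apply: eq_csum => j; rewrite scaleN1r.
Qed.

Lemma linear_csum (h : V -> V) p f : linear h -> fsupp f ->
  h (csum p f) = csum p (fun j => h (f j)).
Proof.
move=> Hh Hf; rewrite /csum linear_lsum //; last exact: fsuppZ.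
apply: eq_lsum => j; have := Hh (ncoef p j)%:R (f j) 0.
by rewrite (linear_at0 Hh) !addr0.
Qed.

(** [(1 - S) (1 - S)^(-p-1) = (1 - S)^(-p)]; on coefficients it is Pascal's rule [ncoefSS]. *)
Lemma csum_shift p f : fsupp f ->
  csum p.+1 f - csum p.+1 (fun j => f j.+1) = csum p f.
Proof.
move=> Hf; rewrite /csum.
have HfS : fsupp (fun j => f j.+1).
  by case: Hf => N HN; exists N => j Hj; apply: HN; apply: leqW.
rewrite lsum_recl; last exact: fsuppZ.
rewrite [RHS]lsum_recl; last exact: fsuppZ.
rewrite !ncoef_0r -addrA; congr (_ + _).
apply/eqP; rewrite subr_eq -lsumD; try exact: (fsuppZ _ HfS).
by apply/eqP/eq_lsum => j; rewrite ncoefSS natrD scalerDl.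
Qed.

(** [1 - S] is injective on finitely supported sequences: equality holds far out and propagates
    downwards. *)
Lemma eventually_eq f g : (forall t, f t - f t.+1 = g t - g t.+1) ->
  fsupp f -> fsupp g -> f =1 g.
Proof.
move=> E [N HN] [M HM].
have H d t : (maxn N M <= t + d)%N -> f t = g t.
  elim: d t => [|d IH] t.
    by rewrite addn0 geq_max => /andP [/HN -> /HM ->].
  rewrite addnS -addSn => /IH Ht; have := E t; rewrite Ht.
  by move/addIr.
by move=> t; apply: (H (maxn N M)); apply: leq_addl.
Qed.

Lemma fsupp_csum p f : fsupp f -> fsupp (fun t => csum p (fun j => f (t + j)%N)).
Proof.
case=> N HN; exists N => t Ht; rewrite -[RHS](csum_zero p).
by apply: eq_csum => j; apply: HN; apply: leq_trans Ht (leq_addr _ _).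
Qed.

(* (1 - t)^(-p) (1 - t)^(-q) = (1 - t)^(-p-q) *)
Lemma csum_csum p q f : fsupp f ->
  csum q (fun i => csum p (fun j => f (i + j)%N)) = csum (q + p) f.
Proof.
move=> Hf.
(* The base point [t] is freed so that each step of the induction on [q'] can cancel one factor
   [1 - S] by [eventually_eq]. *)
suff H q' : (fun t => csum q' (fun i => csum p (fun j => f (t + i + j)%N))) =1
    (fun t => csum (q' + p) (fun j => f (t + j)%N)) by exact: (H q 0%N).
have Hsupp r t : fsupp (fun i => csum r (fun j => f (t + i + j)%N)).
  case: (fsupp_csum r Hf) => N HN; exists N => i Hi.
  by apply: HN; apply: leq_trans Hi (leq_addl _ _).
have Hsh t : fsupp (fun j => f (t + j)%N).
  by case: Hf => N HN; exists N => j Hj; apply: HN; apply: leq_trans Hj (leq_addl _ _).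
elim: q' => [|q' IH].
  by move=> t; rewrite csum0; apply: eq_csum => j; rewrite addn0.
apply: eventually_eq; last exact: fsupp_csum.
  move=> t; rewrite addSn -[X in _ - X](@eq_csum _ (fun i =>
    csum p (fun j => f (t + i.+1 + j)%N))) => [|i]; last by rewrite addSnnS.
  rewrite (csum_shift _ (Hsupp p t)) IH -(csum_shift _ (Hsh t)).
  by congr (_ - _); apply: eq_csum => j; rewrite addSnnS.
case: (fsupp_csum p Hf) => N HN; exists N => t Ht.
rewrite -[RHS](csum_zero q'.+1); apply: eq_csum => i; apply: HN.
exact: leq_trans Ht (leq_addr _ _).
Qed.

Lemma dsupp_row (f : nat -> nat -> V) i : dsupp f -> fsupp (f i).
Proof. by case=> N HN; exists N => j Hj; apply: HN; rewrite Hj orbT. Qed.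

Lemma dsupp_csum p (f : nat -> nat -> V) : dsupp f ->
  fsupp (fun i => csum p (f i)).
Proof.
case=> N HN; exists N => i Hi; rewrite -[RHS](csum_zero p).
by apply: eq_csum => j; rewrite HN ?Hi.
Qed.

Lemma dsupp_swap (f : nat -> nat -> V) : dsupp f -> dsupp (fun i j => f j i).
Proof. by case=> N HN; exists N => i j; rewrite orbC => /HN. Qed.

(** The bound on [i] may depend on [j], but only finitely many [j] matter. Mixed products have this
    shape: one field acts on a vector that depends on the other index. *)
Lemma dsuppI (f : nat -> nat -> V) :
  (exists J, forall i j, (J <= j)%N -> f i j = 0) ->
  (forall j, fsupp (f^~ j)) -> dsupp f.
Proof.
case=> J HJ Hf.
suff [M HM] : exists M, forall i j, (j < J)%N -> (M <= i)%N -> f i j = 0.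
  exists (maxn J M) => i j H; have [Hj|Hj] := ltnP j J; last exact: HJ.
  by apply: HM => //; lia.
elim: {HJ} J => [|J [M HM]]; first by exists 0%N.
have [N HN] := Hf J; exists (maxn N M) => i j; rewrite ltnS leq_eqVlt.
case/orP=> [/eqP ->|Hj] Hi; first by apply: HN; lia.
by apply: HM => //; lia.
Qed.

Lemma csum_exchange p q (f : nat -> nat -> V) : dsupp f ->
  csum q (fun i => csum p (f i)) = csum p (fun j => csum q (f^~ j)).
Proof.
move=> Hf; have H i := dsupp_row i Hf; have H' j := dsupp_row j (dsupp_swap Hf).
rewrite /csum.
transitivity (dsum (fun i j => (ncoef q i)%:R *: ((ncoef p j)%:R *: f i j))).
  by apply: eq_lsum => i; rewrite lsumZ //; apply: fsuppZ.
rewrite dsum_exchange.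
  apply: eq_lsum => j; rewrite -lsumZ; last exact: fsuppZ.
  by apply: eq_lsum => i; rewrite !scalerA mulrC.
by case: Hf => N HN; exists N => i j /HN ->; rewrite !scaler0.
Qed.

End LocallyFiniteSums.


(** * Formal fields, their products against powers of z1 - z2, and commutators *)

Section Fields.
Variables (F : fieldType) (V : lmodType F).
Implicit Types (A X Y Z W : int -> V -> V) (v : V).

Definition isfield A : Prop :=
  (forall n, linear (A n)) /\
  (forall v, exists N : nat, forall n, N%:Z <= n -> A n v = 0).

Lemma fieldD A n u v : isfield A -> A n (u + v) = A n u + A n v.
Proof. by case=> H _; have := H n 1 u v; rewrite !scale1r. Qed.
Lemma field0 A n : isfield A -> A n 0 = 0.
Proof. by case=> H _; apply: linear_at0. Qed.
Lemma fieldZ A n c v : isfield A -> A n (c *: v) = c *: A n v.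
Proof. by move=> H; rewrite -[c *: v]addr0 H.1 field0 ?addr0. Qed.
Lemma fieldB A n u v : isfield A -> A n (u - v) = A n u - A n v.
Proof. by move=> H; rewrite fieldD // -scaleN1r fieldZ // scaleN1r. Qed.

Lemma eventually_all (P : nat -> int -> Prop) J :
  (forall j, exists N : nat, forall n, N%:Z <= n -> P j n) ->
  exists N : nat, forall j n, (j < J)%N -> N%:Z <= n -> P j n.
Proof.
move=> H; elim: J => [|J [N HN]]; first by exists 0%N.
have [M HM] := H J; exists (maxn N M) => j n; rewrite ltnS leq_eqVlt.
case/orP=> [/eqP ->|Hj] Hn; first by apply: HM; lia.
by apply: HN => //; lia.
Qed.

Section Products.
Variables (p : nat) (Z A : int -> V -> V).
Hypotheses (HZ : isfield Z) (HA : isfield A).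

Definition pterm l n v j := Z (l - (p + j)%N%:Z) (A (n + j%:Z) v).
Definition mterm l n v j := A (n - (p + j)%N%:Z) (Z (l + j%:Z) v).

Lemma pterm_fsupp l n v : fsupp (pterm l n v).
Proof.
have [N HN] := HA.2 v; exists `|N%:Z - n|%N => j Hj.
by rewrite /pterm HN ?field0 //; lia.
Qed.
Lemma mterm_fsupp l n v : fsupp (mterm l n v).
Proof.
have [N HN] := HZ.2 v; exists `|N%:Z - l|%N => j Hj.
by rewrite /mterm HN ?field0 //; lia.
Qed.

(* The coefficient of z1^(-l-1) z2^(-n-1) in
   (z1 - z2)^(-p) Z(z1) A(z2) - (-z2 + z1)^(-p) A(z2) Z(z1). *)
Definition sprod l n v :=
  csum p (pterm l n v) - (-1) ^+ p *: csum p (mterm l n v).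

Lemma pterm_linear l n c u v j :
  pterm l n (c *: u + v) j = c *: pterm l n u j + pterm l n v j.
Proof. by rewrite /pterm !(fieldD, fieldZ). Qed.
Lemma mterm_linear l n c u v j :
  mterm l n (c *: u + v) j = c *: mterm l n u j + mterm l n v j.
Proof. by rewrite /mterm !(fieldD, fieldZ). Qed.

Lemma csum_linear (t : V -> nat -> V) c u v :
  (forall v, fsupp (t v)) -> 
  (forall c u v j, t (c *: u + v) j = c *: t u j + t v j) ->
  csum p (t (c *: u + v)) = c *: csum p (t u) + csum p (t v).
Proof.
move=> Ht H; rewrite -csumZ // -csumD //; last exact: fsuppZ.
by apply: eq_csum => j; rewrite H.
Qed.

Lemma sprod_linear l n : linear (sprod l n).
Proof.
move=> c u v; rewrite /sprod.
rewrite (csum_linear _ _ _ (pterm_fsupp l n) (pterm_linear l n)).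
rewrite (csum_linear _ _ _ (mterm_fsupp l n) (mterm_linear l n)).
by lmod F.
Qed.

Lemma pterm_trunc l v : exists N : nat, forall n, N%:Z <= n -> csum p (pterm l n v) = 0.
Proof.
have [N HN] := HA.2 v; exists N => n Hn; rewrite -[RHS](csum_zero V p).
by apply: eq_csum => j; rewrite /pterm HN ?field0 //; lia.
Qed.
Lemma mterm_trunc l v : exists N : nat, forall n, N%:Z <= n -> csum p (mterm l n v) = 0.
Proof.
have [J HJ] := HZ.2 v.
(* The bound for [A] depends on the vector [Z (l + j) v], which is zero for large [j], so finitely
   many bounds suffice. *)
have /(eventually_all `|J%:Z - l|%N) [N HN] : forall j, exists N : nat, forall n,
    N%:Z <= n -> mterm l n v j = 0.
  move=> j; have [N HN] := HA.2 (Z (l + j%:Z) v).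
  by exists (N + (p + j))%N => n Hn; apply: HN; lia.
exists N => n Hn; rewrite -[RHS](csum_zero V p); apply: eq_csum => j.
have [Hj|Hj] := ltnP j `|J%:Z - l|%N; first exact: HN.
by rewrite /mterm HJ ?field0 //; lia.
Qed.

Lemma sprod_field l : isfield (sprod l).
Proof.
split=> [n|v]; first exact: sprod_linear.
have [N HN] := pterm_trunc l v; have [M HM] := mterm_trunc l v.
exists (maxn N M) => n Hn; rewrite /sprod HN ?HM ?scaler0 ?subr0 //; lia.
Qed.
End Products.

(* Multiplication by z1 - z2. *)
Definition delta (C : int -> int -> V -> V) : int -> int -> V -> V :=
  fun l n v => C (l + 1) n v - C l (n + 1) v.

(** Both expansions of [(z1 - z2)^(-p-1)] lose one factor by [csum_shift]. Repeating this [p] times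
    brings a product of exponent [p] down to a commutator, by [sprod0]. *)
Lemma delta_sprod p Z A : isfield Z -> isfield A ->
  delta (sprod p.+1 Z A) = sprod p Z A.
Proof.
move=> HZ HA; apply/funext => l; apply/funext => n; apply/funext => v.
rewrite /delta /sprod.
rewrite -(csum_shift p (pterm_fsupp p HZ HA l n v)).
rewrite -(csum_shift p (mterm_fsupp p HZ HA l n v)).
set P := csum p.+1 (pterm p Z A l n v); set M := csum p.+1 (mterm p Z A l n v).
have -> : csum p.+1 (pterm p.+1 Z A (l + 1) n v) = P.
  by apply: eq_csum => j; rewrite /pterm; congr (Z _ _); lia.
have -> : csum p.+1 (mterm p.+1 Z A l (n + 1) v) = M.
  by apply: eq_csum => j; rewrite /mterm; congr (A _ _); lia.
have -> : csum p.+1 (pterm p.+1 Z A l (n + 1) v) =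
    csum p.+1 (fun j => pterm p Z A l n v j.+1).
  by apply: eq_csum => j; rewrite /pterm; congr (Z _ (A _ _)); lia.
have -> : csum p.+1 (mterm p.+1 Z A (l + 1) n v) =
    csum p.+1 (fun j => mterm p Z A l n v j.+1).
  by apply: eq_csum => j; rewrite /mterm; congr (A _ (Z _ _)); lia.
by rewrite exprS; lmod F.
Qed.

Definition commf X A : int -> int -> V -> V :=
  fun l n v => X l (A n v) - A n (X l v).

Lemma sprod0 Z A : sprod 0 Z A = commf Z A.
Proof.
apply/funext => l; apply/funext => n; apply/funext => v.
rewrite /sprod !csum0 /pterm /mterm /commf expr0 scale1r.
by congr (Z _ (A _ _) - A _ (Z _ _)); lia.
Qed.

Lemma commf_field X A l : isfield X -> isfield A -> isfield (commf X A l).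
Proof.
move=> HX HA; rewrite /commf; split=> [n c u v|v].
  by rewrite !(fieldD, fieldZ) //; lmod F.
have [N HN] := HA.2 v; have [M HM] := HA.2 (X l v).
by exists (maxn N M) => n Hn; rewrite HN ?HM ?field0 ?subr0 //; lia.
Qed.

Lemma delta_field (C : int -> int -> V -> V) :
  (forall l, isfield (C l)) -> forall l, isfield (delta C l).
Proof.
move=> HC l; split=> [n c u v|v].
  by rewrite /delta !(fieldD, fieldZ) //; lmod F.
have [N HN] := (HC (l + 1)).2 v; have [M HM] := (HC l).2 v.
by exists (maxn N M) => n Hn; rewrite /delta HN ?HM ?subr0 //; lia.
Qed.

Lemma sprodP p Z c A B l n v : isfield Z -> isfield A -> isfield B ->
  sprod p Z (fun n v => c *: A n v + B n v) l n v =
  c *: sprod p Z A l n v + sprod p Z B l n v.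
Proof.
move=> HZ HA HB; rewrite /sprod.
rewrite (@eq_csum _ _ _ _
  (fun j => c *: pterm p Z A l n v j + pterm p Z B l n v j)) => [|j]; last first.
  by rewrite /pterm fieldD // fieldZ.
rewrite [csum p (mterm _ _ (fun _ _ => _) _ _ _)](_ : _ = csum p
  (fun j => c *: mterm p Z A l n v j + mterm p Z B l n v j)); last by [].
have HP := pterm_fsupp p HZ HA l n v; have HM := mterm_fsupp p HZ HA l n v.
rewrite !csumD ?csumZ //; try exact: pterm_fsupp; try exact: mterm_fsupp.
  by lmod F.
all: exact: fsuppZ.
Qed.

Lemma sprodB p Z A B l n v : isfield Z -> isfield A -> isfield B ->
  sprod p Z (fun n v => A n v - B n v) l n v = sprod p Z A l n v - sprod p Z B l n v.
Proof.
move=> HZ HA HB; rewrite (_ : (fun n v => A n v - B n v) =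
  fun n v => -1 *: B n v + A n v); last first.
  by apply/funext => m; apply/funext => w; rewrite scaleN1r addrC.
by rewrite sprodP // scaleN1r addrC.
Qed.

Lemma sprodZl p c Z A l n v : isfield Z -> isfield A ->
  sprod p (fun n v => c *: Z n v) A l n v = c *: sprod p Z A l n v.
Proof.
move=> HZ HA; rewrite /sprod scalerBr scalerA mulrC -scalerA.
rewrite -csumZ; last exact: pterm_fsupp.
rewrite -csumZ; last exact: mterm_fsupp.
congr (_ - _ *: _); apply: eq_csum => j.
by rewrite /mterm fieldZ.
Qed.

Lemma sprod_shift p Z A l n v :
  sprod p Z (fun n => A (n + 1)) l n v = sprod p Z A l (n + 1) v.
Proof.
rewrite /sprod; congr (_ - _ *: _); apply: eq_csum => j.
  by rewrite /pterm; congr (Z _ (A _ _)); lia.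
by rewrite /mterm; congr (A _ _); lia.
Qed.

Lemma delta_sprod_family p Y (C : int -> int -> V -> V) :
  isfield Y -> (forall l, isfield (C l)) ->
  delta (fun l => sprod p Y (C l) 0) = (fun l => sprod p Y (delta C l) 0).
Proof.
move=> HY HC; apply/funext => l; apply/funext => n; apply/funext => v.
rewrite /delta sprodB //; first by rewrite -sprod_shift.
split=> [m|w]; first exact: (HC l).1.
have [N HN] := (HC l).2 w; exists N => m Hm; apply: HN; lia.
Qed.

(* The central element, acting as the field k id. *)
Definition kfield (k : F) (n : int) (v : V) : V := if n == -1 then k *: v else 0.

Lemma kfield_field k : isfield (kfield k).
Proof.
rewrite /kfield; split=> [n c u v|v].
  by case: ifP => _; [lmod F|rewrite scaler0 addr0].
by exists 0%N => n Hn; case: eqP => // ?; lia.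
Qed.

Section Derivation.
Variables (X Y W : int -> V -> V) (c k : F).
Hypotheses (HX : isfield X) (HY : isfield Y) (HW : isfield W).
Hypothesis HXY : forall l m v,
  X l (Y m v) = Y m (X l v) + W (l + m) v + (c * l%:~R) *: kfield k (l + m - 1) v.

(** [[X_l, -]] is a derivation of the product. Since [[X_l, Y_m]] has modes [l + m], the residue row
    0 moves to row [l] for [W] and to row [l - 1] for the central field. *)
Lemma commf_sprod p A l n v : isfield A ->
  commf X (sprod p Y A 0) l n v =
  sprod p Y (commf X A l) 0 n v + sprod p W A l n v
  + (c * l%:~R) *: sprod p (kfield k) A (l - 1) n v.
Proof.
move=> HA; have HK := kfield_field k.
have HC := commf_field l HX HA.
rewrite [LHS]/commf /sprod (fieldB _ _ _ HX) (fieldZ _ _ _ HX).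
rewrite !(linear_csum p (HX.1 l)); try exact: pterm_fsupp; try exact: mterm_fsupp.
rewrite (@eq_csum _ _ _ (fun j => X l (pterm p Y A 0 n v j)) (fun j =>
  pterm p Y A 0 n (X l v) j + (pterm p Y (commf X A l) 0 n v j
    + (pterm p W A l n v j + (c * l%:~R) *: pterm p (kfield k) A (l - 1) n v j))));
    last first.
  move=> j; rewrite /pterm /commf HXY fieldB //.
  have -> : l + (0 - (p + j)%N%:Z) = l - (p + j)%N%:Z by lia.
  have -> : l - (p + j)%N%:Z - 1 = l - 1 - (p + j)%N%:Z by lia.
  by lmod F.
rewrite (@eq_csum _ _ _ (fun j => X l (mterm p Y A 0 n v j)) (fun j =>
  mterm p Y A 0 n (X l v) j + (mterm p Y (commf X A l) 0 n v j
    + (mterm p W A l n v j + (c * l%:~R) *: mterm p (kfield k) A (l - 1) n v j))));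
    last first.
  move=> j; rewrite /mterm /commf !add0r.
  have -> : l - 1 + j%:Z = l + j%:Z - 1 by lia.
  rewrite HXY !fieldD // fieldZ //.
  by lmod F.
have H1 := pterm_fsupp p; have H2 := mterm_fsupp p.
have Hk1 := fsuppZ (fun=> c * l%:~R) (H1 _ _ HK HA (l - 1) n v).
have Hk2 := fsuppZ (fun=> c * l%:~R) (H2 _ _ HK HA (l - 1) n v).
have Hw1 := fsuppD (H1 _ _ HW HA l n v) Hk1.
have Hw2 := fsuppD (H2 _ _ HW HA l n v) Hk2.
have Hc1 := fsuppD (H1 _ _ HY HC 0 n v) Hw1.
have Hc2 := fsuppD (H2 _ _ HY HC 0 n v) Hw2.
move: (commf X A l) HC Hc1 Hc2 => C HC Hc1 Hc2.
rewrite !csumD //; try exact: H1; try exact: H2.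
rewrite !csumZ //; try exact: H1; try exact: H2.
by lmod F.
Qed.
End Derivation.

End Fields.


(** * Commutators of iterated products, and locality *)

Section ProductCommutator.
Variables (F : fieldType) (V : lmodType F).
Implicit Types (A X Y Z W : int -> V -> V) (v : V).

(* The four parts of an iterated product, named after the order of factors. *)
Section Expand.
Variables (q p : nat) (X Y A : int -> V -> V) (n : int) (v : V).
Hypotheses (HX : isfield X) (HY : isfield Y) (HA : isfield A).

Definition xya i j := X (0 - (q + i)%N%:Z) (Y (0 - (p + j)%N%:Z) (A (n + (i + j)%N%:Z) v)).
Definition xay i j := X (0 - (q + i)%N%:Z) (A (n + i%:Z - (p + j)%N%:Z) (Y j%:Z v)).
Definition yax i j := Y (0 - (p + j)%N%:Z) (A (n + j%:Z - (q + i)%N%:Z) (X i%:Z v)).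
Definition ayx i j := A (n - (q + i + (p + j))%N%:Z) (Y j%:Z (X i%:Z v)).

Lemma xya_dsupp : dsupp xya.
Proof.
have [N HN] := HA.2 v; exists `|N%:Z - n|%N => i j H.
by rewrite /xya HN ?field0 //; lia.
Qed.
Lemma xay_dsupp : dsupp xay.
Proof.
apply: dsuppI => [|j].
  have [N HN] := HY.2 v; exists N => i j Hj.
  by rewrite /xay HN ?field0 //; lia.
have [N HN] := HA.2 (Y j%:Z v); exists (absz (N%:Z - n + (p + j)%N%:Z)%R) => i Hi.
by rewrite /xay HN ?field0 //; lia.
Qed.
Lemma yax_dsupp : dsupp yax.
Proof.
apply: (@dsupp_swap _ _ (fun j i => yax i j)); apply: dsuppI => [|i].
  have [N HN] := HX.2 v; exists N => j i Hi.
  by rewrite /yax HN ?field0 //; lia.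
have [N HN] := HA.2 (X i%:Z v); exists (absz (N%:Z - n + (q + i)%N%:Z)%R) => j Hj.
by rewrite /yax HN ?field0 //; lia.
Qed.
Lemma ayx_dsupp : dsupp ayx.
Proof.
apply: (@dsupp_swap _ _ (fun j i => ayx i j)); apply: dsuppI => [|i].
  have [N HN] := HX.2 v; exists N => j i Hi.
  by rewrite /ayx HN ?field0 //; lia.
have [N HN] := HY.2 (X i%:Z v); exists N => j Hj.
by rewrite /ayx HN ?field0 //; lia.
Qed.

Definition csum2 (f : nat -> nat -> V) := csum q (fun i => csum p (f i)).

Lemma sprod_sprod : sprod q X (sprod p Y A 0) 0 n v =
  (csum2 xya - (-1) ^+ p *: csum2 xay)
  - (-1) ^+ q *: (csum2 yax - (-1) ^+ p *: csum2 ayx).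
Proof.
rewrite {1}/sprod; congr (_ - _ *: _).
  rewrite -csumZ; last exact: dsupp_csum xay_dsupp.
  rewrite -csumB; [|exact: dsupp_csum xya_dsupp|
    exact/fsuppZ/dsupp_csum/xay_dsupp].
  apply: eq_csum => i; rewrite /pterm /sprod fieldB // fieldZ //.
  rewrite !(linear_csum p (HX.1 _)); try exact: pterm_fsupp; try exact: mterm_fsupp.
  congr (_ - _ *: _); apply: eq_csum => j.
    by rewrite /pterm /xya; congr (X _ (Y _ (A _ _))); lia.
rewrite -csumZ; last exact: dsupp_csum ayx_dsupp.
rewrite -csumB; [|exact: dsupp_csum yax_dsupp|
  exact/fsuppZ/dsupp_csum/ayx_dsupp].
apply: eq_csum => i; rewrite /mterm /sprod.
congr (_ - _ *: _); apply: eq_csum => j.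
  by rewrite /pterm /yax; congr (Y _ (A _ _)); lia.
by rewrite /mterm /ayx; congr (A _ (Y _ _)); lia.
Qed.
End Expand.

Lemma sprod_comm q p X Y W A n v :
  (0 < q)%N -> (0 < p)%N ->
  isfield X -> isfield Y -> isfield W -> isfield A ->
  (forall l m v, l < 0 -> m < 0 -> X l (Y m v) = Y m (X l v) + W (l + m) v) ->
  (forall (i j : nat) v, X i%:Z (Y j%:Z v) = Y j%:Z (X i%:Z v) + W (i + j)%N%:Z v) ->
  sprod q X (sprod p Y A 0) 0 n v =
  sprod p Y (sprod q X A 0) 0 n v + sprod (q + p) W A 0 n v.
Proof.
move=> q0 p0 HX HY HW HA Hneg Hpos; rewrite !sprod_sprod // /csum2.
rewrite ![csum p (fun i => csum q _)]csum_exchange;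
  try exact: xya_dsupp; try exact: xay_dsupp; try exact: yax_dsupp;
  try exact: ayx_dsupp.
have E3 i j : xya q p X Y A n v i j =
    xya p q Y X A n v j i + pterm (q + p) W A 0 n v (i + j)%N.
  rewrite /xya Hneg; try lia; congr (Y _ (X _ (A _ _)) + _); first by lia.
  by rewrite /pterm; congr (W _ _); lia.
have E4 i j : ayx q p X Y A n v i j =
    ayx p q Y X A n v j i - mterm (q + p) W A 0 n v (i + j)%N.
  rewrite /ayx /mterm Hpos fieldD // add0r.
  rewrite [X in _ + X - _](_ : _ = A (n - (q + p + (i + j))%N%:Z) (W (i + j)%N%:Z v));
    last by congr (A _ _); lia.
  by rewrite addrK; congr (A _ _); lia.
have HP := pterm_fsupp (q + p) HW HA 0 n v.
have HM := mterm_fsupp (q + p) HW HA 0 n v.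
have Hsh (f : nat -> V) i : fsupp f -> fsupp (fun j => f (i + j)%N).
  by case=> N HN; exists N => j Hj; apply: HN; lia.
have Hx := dsupp_swap (xya_dsupp p q n v HY HX HA).
have Ha := dsupp_swap (ayx_dsupp p q n v HY HX HA).
have -> : csum q (fun i => csum p (xya q p X Y A n v i)) =
    csum q (fun i => csum p (fun j => xya p q Y X A n v j i))
    + csum (q + p) (pterm (q + p) W A 0 n v).
  rewrite -csum_csum // -csumD; try exact: dsupp_csum; try exact: fsupp_csum.
  apply: eq_csum => i; rewrite -csumD; try exact: (dsupp_row i Hx); try exact: Hsh.
  by apply: eq_csum => j; rewrite E3.
have -> : csum q (fun i => csum p (ayx q p X Y A n v i)) =
    csum q (fun i => csum p (fun j => ayx p q Y X A n v j i))
    - csum (q + p) (mterm (q + p) W A 0 n v).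
  rewrite -csum_csum // -csumB; try exact: dsupp_csum; try exact: fsupp_csum.
  apply: eq_csum => i; rewrite -csumB; try exact: (dsupp_row i Ha); try exact: Hsh.
  by apply: eq_csum => j; rewrite E4.
rewrite /sprod exprD.
move: (csum (q + p) _) (csum (q + p) _) => P M.
by lmod F.
Qed.

Local Notation fam := (int -> int -> V -> V).
Implicit Types C : fam.
Local Notation zfam := (fun (_ _ : int) (_ : V) => 0 : V).

Lemma fam_ext C C' : (forall l n v, C l n v = C' l n v) -> C = C'.
Proof.
by move=> E; apply/funext => l; apply/funext => n; apply/funext => v.
Qed.

Lemma delta_zero : delta zfam = zfam.
Proof. by apply: fam_ext => l n v; rewrite /delta subr0. Qed.

Lemma iter_delta_zero q : iter q (@delta F V) zfam = zfam.
Proof. by elim: q => //= q ->; apply: delta_zero. Qed.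

Lemma iter_delta_le q r C : (q <= r)%N ->
  iter q (@delta F V) C = zfam -> iter r (@delta F V) C = zfam.
Proof.
by move=> /subnK <- H; rewrite iterD H iter_delta_zero.
Qed.

Lemma iter_deltaP q c C C' :
  iter q (@delta F V) (fun l n v => c *: C l n v + C' l n v) =
  fun l n v => c *: iter q (@delta F V) C l n v + iter q (@delta F V) C' l n v.
Proof.
elim: q => //= q ->; apply: fam_ext => l n v; rewrite /delta.
by lmod F.
Qed.

Lemma iter_delta_field q C : (forall l, isfield (C l)) ->
  forall l, isfield (iter q (@delta F V) C l).
Proof. by move=> HC; elim: q => //= q; apply: delta_field. Qed.

Lemma iter_delta_sprod q p Z A : isfield Z -> isfield A -> (q <= p)%N ->
  iter q (@delta F V) (sprod p Z A) = sprod (p - q) Z A.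
Proof.
move=> HZ HA; elim: q => [|q IH] Hq /=; first by rewrite subn0.
have := delta_sprod (p - q.+1) HZ HA.
by rewrite (subnSK Hq) (IH (ltnW Hq)).
Qed.

Lemma iter_delta_sprod_ge q p Z A : isfield Z -> isfield A -> (p <= q)%N ->
  iter q (@delta F V) (sprod p Z A) = iter (q - p) (@delta F V) (commf Z A).
Proof.
move=> HZ HA Hq; rewrite -{1}(subnK Hq) iterD.
by rewrite iter_delta_sprod // subnn sprod0.
Qed.

Lemma iter_delta_sprod_family q p Y C : isfield Y -> (forall l, isfield (C l)) ->
  iter q (@delta F V) (fun l => sprod p Y (C l) 0) =
  (fun l => sprod p Y (iter q (@delta F V) C l) 0).
Proof.
move=> HY HC; elim: q => //= q ->; apply: delta_sprod_family => //.
exact: iter_delta_field.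
Qed.

(** Minus the derivative in [z1], produced by the factor [l] of the central term;
    [iter_delta_weighted] is its Leibniz rule with [(z1 - z2)^q]. *)
Definition weighted C : fam := fun l n v => l%:~R *: C (l - 1) n v.

Lemma iter_delta_weighted q C :
  iter q (@delta F V) (weighted C) =
  fun l n v => l%:~R *: iter q (@delta F V) C (l - 1) n v
    + q%:R *: iter q.-1 (@delta F V) C l n v.
Proof.
elim: q => [|q IH] /=; first by apply: fam_ext => l n v; rewrite scale0r addr0.
rewrite {}IH; apply: fam_ext => l n v; rewrite /delta addrK subrK rmorphD /=.
case: q => [|q] /=; first by lmod F.
by rewrite /delta; lmod F.
Qed.

Variable k : F.

Lemma commf_kfield A : isfield A -> commf (kfield k) A = zfam.
Proof.
move=> HA; apply: fam_ext => l n v; rewrite /commf /kfield.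
by case: ifP => _; rewrite ?fieldZ ?field0 // subrr.
Qed.

Lemma sprod_kfield r A n v : isfield A ->
  sprod r.+1 (kfield k) A 0 n v = if r == 0%N then k *: A n v else 0.
Proof.
move=> HA; rewrite /sprod; have -> : csum r.+1 (mterm r.+1 (kfield k) A 0 n v) = 0.
  rewrite -[RHS](csum_zero V r.+1); apply: eq_csum => j.
  by rewrite /mterm /kfield (negbTE (_ : _ != _)) ?field0 //; lia.
rewrite scaler0 subr0 /csum (@lsum1 _ _ 0) => [|j Hj]; last first.
  by rewrite /pterm /kfield (negbTE (_ : _ != _)) ?scaler0 //; lia.
rewrite ncoef_0r scale1r /pterm /kfield.
have -> : (0 - (r.+1 + 0)%N%:Z == -1) = (r == 0%N) by lia.
by case: ifP => _ //; congr (_ *: A _ _); lia.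
Qed.

(** For [q > p] a commutator with a scalar is left. For [0 < q < p] a pole of order at least 2
    against a constant field has no residue. Only the simple pole at [q = p] contributes. *)
Lemma iter_delta_kfield q p A n v : isfield A ->
  q%:R *: iter q.-1 (@delta F V) (sprod p (kfield k) A) 0 n v =
  if (q == p) then (q%:R * k) *: A n v else 0.
Proof.
move=> HA; have HK := kfield_field V k.
case: q => [|q]; first by rewrite scale0r mul0r scale0r; case: ifP.
have [Hq|Hq] := ltnP q p.
  rewrite iter_delta_sprod //= 1?ltnW // -(subnSK Hq) sprod_kfield //.
  have -> : (p - q.+1 == 0)%N = (q.+1 == p) by lia.
  by case: ifP => _; rewrite ?scaler0 // scalerA.
rewrite iter_delta_sprod_ge //= commf_kfield // iter_delta_zero scaler0.
by rewrite gtn_eqF.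
Qed.

Section Derivation.
Variables (X Y Z : int -> V -> V) (c d : F).
Hypotheses (HX : isfield X) (HY : isfield Y) (HZ : isfield Z).
Hypothesis HXY : forall l m v,
  X l (Y m v) = Y m (X l v) + d *: Z (l + m) v
  + (c * l%:~R) *: kfield k (l + m - 1) v.

Lemma iter_delta_comm q p A : isfield A ->
  iter q (@delta F V) (commf X (sprod p Y A 0)) =
  fun l n v => sprod p Y (iter q (@delta F V) (commf X A) l) 0 n v
  + d *: iter q (@delta F V) (sprod p Z A) l n v
  + c *: iter q (@delta F V) (weighted (sprod p (kfield k) A)) l n v.
Proof.
move=> HA.
have HW : isfield (fun n v => d *: Z n v).
  split=> [n a u v|v]; first by rewrite !(fieldD, fieldZ) //; lmod F.
  by have [N HN] := HZ.2 v; exists N => n /HN ->; rewrite scaler0.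
rewrite [commf X (sprod p Y A 0)](_ : _ = fun l n v =>
  c *: weighted (sprod p (kfield k) A) l n v + (fun l n v =>
  d *: sprod p Z A l n v + (fun l n v => sprod p Y (commf X A l) 0 n v) l n v) l n v).
  rewrite !iter_deltaP iter_delta_sprod_family // => [|l]; last exact: commf_field.
  by apply: fam_ext => l n v; lmod F.
apply: fam_ext => l n v; rewrite (commf_sprod HX HY HW HXY) // sprodZl //.
by rewrite /weighted; lmod F.
Qed.

Lemma iter_delta_comm0 q p A n v : isfield A ->
  iter q (@delta F V) (commf X (sprod p Y A 0)) 0 n v =
  sprod p Y (iter q (@delta F V) (commf X A) 0) 0 n v
  + d *: iter q (@delta F V) (sprod p Z A) 0 n v
  + c *: (if q == p then (q%:R * k) *: A n v else 0).
Proof.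
move=> HA; rewrite iter_delta_comm // iter_delta_weighted mulr0z scale0r add0r.
by rewrite iter_delta_kfield.
Qed.

Lemma sprod_zero p l n v : isfield Y -> sprod p Y (fun _ _ => 0) l n v = 0.
Proof.
move=> H; rewrite /sprod [csum p (pterm _ _ _ _ _ _)](_ : _ = 0); last first.
  by rewrite -[RHS](csum_zero V p); apply: eq_csum => j; rewrite /pterm field0.
rewrite [csum p (mterm _ _ _ _ _ _)](_ : _ = 0) ?scaler0 ?subr0 //.
by rewrite -[RHS](csum_zero V p); apply: eq_csum => j.
Qed.

(* A form of Dong's lemma. *)
Lemma locality_sprod p A : isfield A ->
  (exists L, iter L (@delta F V) (commf X A) = zfam) ->
  (exists L, iter L (@delta F V) (commf Z A) = zfam) ->
  exists L, iter L (@delta F V) (commf X (sprod p Y A 0)) = zfam.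
Proof.
(* [L1] kills the commutator with [A] and [p + L2] the product with [Z]; the successors keep the
   predecessor exponent in the Leibniz rule for the central part above [p]. *)
move=> HA [L1 H1] [L2 H2]; exists (L1 + L2 + p).+2.
rewrite iter_delta_comm // (@iter_delta_le L1 _ (commf X A)) //; last by lia.
rewrite iter_delta_sprod_ge //; last by lia.
rewrite (@iter_delta_le L2 _ (commf Z A)) //; last by lia.
have HK := kfield_field V k.
rewrite iter_delta_weighted /=.
have E r : (p <= r)%N -> iter r (@delta F V) (sprod p (kfield k) A) = zfam.
  by move=> Hr; rewrite iter_delta_sprod_ge // commf_kfield // iter_delta_zero.
have := E (L1 + L2 + p).+1; rewrite /= => ->; last by lia.
rewrite delta_zero; apply: fam_ext => l n v.
by rewrite sprod_zero // !scaler0 !addr0 scaler0 add0r.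
Qed.
End Derivation.

(** [delta C = 0] makes [C l n] depend on [l + n] only, so the row [l = 0] determines everything. *)
Lemma delta_invariant C : delta C = zfam -> (forall n v, C 0 n v = 0) -> C = zfam.
Proof.
move=> HD H0; apply: fam_ext => l.
have E l' n v : C (l' + 1) n v = C l' (n + 1) v.
  by apply/eqP; rewrite -subr_eq0 -[_ - _]/(delta C l' n v) HD.
elim/int_ind: l => [|l IH|l IH] n v; first exact: H0.
- by rewrite -addn1 PoszD E IH.
- have -> : n = n - 1 + 1 by lia.
  rewrite -E; have -> : - l.+1%:Z + 1 = - l%:Z by lia.
  exact: IH.
Qed.

(** A local family is a finite combination of derivatives of the formal delta function; the rows
    [l = 0] of its [delta] iterates are, up to scalars, the coefficient fields. *)
Lemma iter_delta_eq0 C : (exists L, iter L (@delta F V) C = zfam) ->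
  (forall q n v, iter q (@delta F V) C 0 n v = 0) -> C = zfam.
Proof.
case=> L; elim: L => // L IH H H0; apply: IH => //.
exact: delta_invariant (H0 L).
Qed.

End ProductCommutator.


(** * Words, weights and charges *)

(* Words with zero coefficient are ignored: [act] keeps the central term even
   when the form vanishes, and that word has the wrong charge. *)
Definition words_in (F : fieldType) (P : pred word) (v : vec F) :=
  all (fun p => (p.1 == 0) || P p.2) v.

Section WordsIn.
Variable F : fieldType.
Implicit Types (P Q : pred word) (v : vec F).

Lemma words_in_scalev P c v : words_in P v -> words_in P (scalev c v).
Proof.
rewrite /words_in /scalev all_map; apply: sub_all => p /= /orP [/eqP ->|->].
  by rewrite mulr0 eqxx.
by rewrite orbT.
Qed.

Lemma words_in_cat P v1 v2 :
  words_in P (v1 ++ v2) = words_in P v1 && words_in P v2.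
Proof. exact: all_cat. Qed.

Lemma words_in_flatten P (I : Type) (s : seq I) (f : I -> vec F) :
  (forall i, words_in P (f i)) -> words_in P (flatten [seq f i | i <- s]).
Proof.
by move=> H; elim: s => //= i s IH; rewrite words_in_cat H.
Qed.

Lemma words_in_linv P Q (f : word -> vec F) v :
  words_in Q v -> (forall w, Q w -> words_in P (f w)) -> words_in P (linv f v).
Proof.
move=> Hv Hf; elim: v Hv => //= p v IH /andP [Hp /IH Hv].
rewrite /linv /= words_in_cat Hv andbT; case/orP: Hp => [/eqP ->|/Hf].
  by rewrite /words_in /scalev all_map; apply/allP => q _ /=; rewrite mul0r eqxx.
exact: words_in_scalev.
Qed.

Lemma sub_words_in P Q v : (forall w, P w -> Q w) -> words_in P v -> words_in Q v.
Proof. by move=> H; apply: sub_all => p /orP [->|/H ->] //; rewrite orbT. Qed.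

Lemma words_in_lext P v (V : lmodType F) (f : word -> V) (G : V -> Prop) :
  G 0 -> (forall u u1, G u -> G u1 -> G (u + u1)) -> (forall c u, G u -> G (c *: u)) ->
  (forall w, P w -> G (f w)) -> words_in P v -> G (lext f v).
Proof.
move=> G0 GD GZ Hf; elim: v => [|p v IH] /=; first by rewrite lext_nil.
case/andP=> Hp /IH Hv; rewrite lext_cons; apply: GD => //.
by case/orP: Hp => [/eqP ->|/Hf /GZ]; rewrite ?scale0r.
Qed.

Lemma words_in_pred0 v : words_in pred0 v -> cls v = 0.
Proof.
rewrite cls_lext; apply: (@words_in_lext pred0 v _ _ (fun u => u = 0)) => //.
  by move=> u w -> ->; rewrite addr0.
by move=> c u ->; rewrite scaler0.
Qed.
End WordsIn.

Definition charge1 (x : sl2) : int :=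
  match x with Hb => 0 | Eb => 1 | Fb => -1 end.
Definition charge (w : word) : int := \sum_(l <- w) charge1 l.1.

Lemma charge_cons x a w : charge ((x, a) :: w) = charge1 x + charge w.
Proof. by rewrite /charge big_cons. Qed.
Lemma charge_cat w1 w2 : charge (w1 ++ w2) = charge w1 + charge w2.
Proof. by rewrite /charge big_cat. Qed.

Lemma wt_cons x a w : wt ((x, a) :: w) = (a.+1 + wt w)%N.
Proof. by []. Qed.

Section Degrees.
Variables (F : fieldType) (k : F).

(** The length bound is stated for annihilation modes only; the later induction on the length of
    words rests on it. *)
Definition act_spec x (n : int) (w t : word) :=
  [&& (wt t)%:Z == (wt w)%:Z - n, charge t == charge1 x + charge w
    & (0 <= n) ==> (size t <= size w)%N].

Lemma act_words x n w : words_in (act_spec x n w) (act k x n w).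
Proof.
elim: w x n => [|[y a] w IH] x n.
  case: (ltP n 0) => Hn; rewrite /= ?Hn /= ?ltNge ?Hn //= /act_spec.
  rewrite wt_cons charge_cons eqxx (negbTE (_ : ~~ (0 <= n))) /=; last by lia.
  by rewrite andbT; lia.
have [Hn|Hn] := ltP n 0.
  rewrite /= Hn /= andbT /act_spec !wt_cons !charge_cons eqxx /=.
  by rewrite oner_eq0 /= andbC /=; lia.
rewrite /= ltNge Hn /= !words_in_cat; apply/and3P; split.
- rewrite /words_in all_map; apply: sub_all (IH x n) => -[c t] /=.
  case/orP=> [->//|]; rewrite /act_spec !wt_cons !charge_cons Hn /=.
  move=> /and3P [/eqP H1 /eqP H2 H3].
  by apply/orP; right; apply/and3P; split=> //; [lia|rewrite H2 addrCA].
- have H z : charge1 z = charge1 x + charge1 y ->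
    words_in (act_spec x n ((y, a) :: w)) (act k z (n - a.+1%:Z) w).
    move=> Hz; have [Hm|Hm] := ltP (n - a.+1%:Z) 0.
      have -> : act k z (n - a.+1%:Z) w =
          [:: (1, (z, `|n - a.+1%:Z|%N.-1) :: w)].
        by case: (w) => [|l s] /=; rewrite Hm.
      rewrite /words_in /= andbT oner_eq0 /act_spec Hn /= !wt_cons !charge_cons Hz addrA.
      by rewrite eqxx leqnn /= andbT; lia.
    apply: sub_words_in (IH z (n - a.+1%:Z)) => t.
    rewrite /act_spec Hm Hn /= wt_cons charge_cons Hz => /and3P [/eqP H1 /eqP H2 H3].
    by apply/and3P; split; [lia|rewrite H2 addrA|lia].
  by case: x y H {IH} => -[] H /=; rewrite ?cats0 ?words_in_scalev ?H.
- case: ifP => [/eqP Hn'|//]; rewrite /words_in /= andbT.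
  have [Hxy|Hxy] := boolP (charge1 x + charge1 y == 0); last first.
    by rewrite (_ : Defs.form F x y = 0) ?mulr0 ?mul0r ?eqxx //; case: x y Hxy {IH} => -[].
  rewrite /act_spec Hn /= wt_cons charge_cons leqnSn andbT addrA (eqP Hxy) add0r.
  by rewrite eqxx andbT; apply/orP; right; lia.
Qed.

Definition prod_spec u (n : int) v (t : word) :=
  (wt t)%:Z == (wt u)%:Z + (wt v)%:Z - n - 1.

Lemma prodw_cons x a u n v : prodw k ((x, a) :: u) n v =
  flatten [seq scalev ('C(a + j, j))%:R
     (linv (act k x (- (a + 1 + j)%N%:Z)) (prodw k u (n + j%:Z) v)
      ++ scalev (- (-1) ^+ a.+1)
           (linv (prodw k u (n - (a + 1 + j)%N%:Z)) (act k x j%:Z v)))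
    | j <- iota 0 (wt ((x, a) :: u) + wt v + `|n|).+1].
Proof. by []. Qed.

Lemma prodw_words u n v : words_in (prod_spec u n v) (prodw k u n v).
Proof.
elim: u n v => [|[x a] u IH] n v.
  rewrite /=; case: eqP => [->|_] //; rewrite /words_in /= andbT oner_eq0 /prod_spec /=.
  by apply/eqP; rewrite /wt /=; lia.
rewrite prodw_cons; apply: words_in_flatten => j; apply: words_in_scalev; rewrite words_in_cat.
apply/andP; split.
  apply: words_in_linv (IH _ _) _ => t Ht.
  apply: sub_words_in (act_words _ _ _) => s /and3P [Hs _ _].
  by move: Ht Hs; rewrite /prod_spec wt_cons; lia.
apply: words_in_scalev; apply: words_in_linv (act_words _ _ _) _ => t.
move=> /and3P [Ht _ _]; apply: sub_words_in (IH _ _) => s Hs.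
by move: Ht Hs; rewrite /prod_spec wt_cons; lia.
Qed.

Lemma op_weight0 x n w : (wt w)%:Z < n -> op k x n (wcls F w) = 0.
Proof.
move=> Hn; rewrite op_w; apply: words_in_pred0.
by apply: sub_words_in (act_words x n w) => t /and3P [/eqP H _ _]; lia.
Qed.

Lemma prodw_weight0 u n w : (wt u + wt w)%N%:Z <= n -> cls (prodw k u n w) = 0.
Proof.
move=> Hn; apply: words_in_pred0.
by apply: sub_words_in (prodw_words u n w) => t /eqP H; lia.
Qed.
End Degrees.

(** * The state-field correspondence *)

Section StateField.
Variables (F : fieldType) (k : F).
Local Notation weyl := (weyl F).
Local Notation op := (op k).
Local Notation vac := (vacuum F).

Lemma op_field x : isfield (op x).
Proof.
split=> [n|v]; first exact: op_linear.
elim/weyl_ind: v => [|c w v [N HN]]; first by exists 0%N => n _; rewrite op0.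
exists (maxn N (wt w).+1) => n Hn; rewrite opD opZ HN ?op_weight0 ?scaler0 ?addr0 //.
  by lia.
by lia.
Qed.

(** In this basis a bracket is a multiple of one basis vector, so the commutator of two currents
    involves a single field; [(0, Hb)] stands for the zero bracket. *)
Lemma br_single x y : exists dz : F * sl2, forall (V : lmodType F) (g : sl2 -> V),
  \sum_(cz <- br F x y) cz.1 *: g cz.2 = dz.1 *: g dz.2.
Proof.
case: x; case: y; rewrite /=; first [
  by exists (0, Hb) => V g; rewrite big_nil scale0r |
  by eexists (_, _) => V g; rewrite big_cons big_nil addr0].
Qed.

Lemma op_comm_kfield x y : exists dz : F * sl2,
  (forall (V : lmodType F) (g : sl2 -> V),
    \sum_(cz <- br F x y) cz.1 *: g cz.2 = dz.1 *: g dz.2) /\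
  (forall l m v, op x l (op y m v) = op y m (op x l v) + dz.1 *: op dz.2 (l + m) v
    + (Defs.form F x y * l%:~R) *: kfield k (l + m - 1) v).
Proof.
have [[d z] H] := br_single x y; exists (d, z); split=> // l m v.
rewrite op_comm (H _ (fun z => op z (l + m) v)); congr (_ + _).
rewrite /central /kfield (_ : (l + m - 1 == -1) = (l + m == 0)); last by lia.
case: ifP => _; last by rewrite scale0r scaler0.
by rewrite scalerA; congr (_ *: _); ring.
Qed.

(** Row 0 of [sprod] is the residue in [z1], so this is the iterate formula of [prodw] with
    untruncated sums. *)
Fixpoint wfield (w : word) : int -> weyl -> weyl :=
  if w is (x, a) :: w' then sprod a.+1 (op x) (wfield w') 0 else kfield 1.

Lemma wfield_field w : isfield (wfield w).
Proof.
elim: w => [|[x a] w IH] /=; first exact: kfield_field.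
exact: sprod_field (op_field x) IH _.
Qed.

Lemma lext_field (f : word -> int -> weyl -> weyl) u :
  (forall w, isfield (f w)) -> isfield (fun n v => lext (fun w => f w n v) u).
Proof.
move=> Hf; split=> [n c v1 v2|v].
  rewrite -lextZ -lextD; apply: eq_lext => w.
  by rewrite fieldD // fieldZ.
elim: u => [|[c w] u [N HN]]; first by exists 0%N => n _; rewrite lext_nil.
have [M HM] := (Hf w).2 v; exists (maxn N M) => n Hn.
by rewrite lext_cons HN ?HM ?scaler0 ?addr0 //; lia.
Qed.

Lemma lext_sprod p x l n v u :
  lext (fun w => sprod p (op x) (wfield w) l n v) u =
  sprod p (op x) (fun n v => lext (fun w => wfield w n v) u) l n v.
Proof.
have HX := op_field x.
elim: u => [|[c w] u IH].
  rewrite lext_nil [X in sprod _ _ X](_ : _ = fun _ _ => 0).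
    by rewrite sprod_zero.
  by apply/funext => m; apply/funext => z; rewrite lext_nil.
rewrite lext_cons IH -sprodP //; try exact: wfield_field; last first.
  exact: lext_field wfield_field.
congr (sprod _ _ _ _ _ _); apply/funext => m; apply/funext => z.
by rewrite lext_cons.
Qed.

Lemma wfield_relator n v u t x a y b :
  lext (fun w => wfield w n v) (relator F u t x a y b) = 0.
Proof.
elim: u n v => [|[z c] u IH] n v.
  rewrite lext_relator /=.
  have [[d z] [Hbr Hc]] := op_comm_kfield x y.
  have HX := op_field x; have HY := op_field y; have HZ := op_field z.
  have HT := wfield_field t.
  have HW : isfield (fun n v => d *: op z n v).
    split=> [m e u v'|u]; first by rewrite opD opZ; lmod F.
    by have [N HN] := HZ.2 u; exists N => m /HN ->; rewrite scaler0.
  rewrite (@sprod_comm _ _ a.+1 b.+1 (op x) (op y) (fun n v => d *: op z n v)) //.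
  - rewrite sprodZl // (Hbr _ (fun z => sprod (a + b).+2 (op z) (wfield t) 0 n v)) /=.
    by rewrite addSn addnS; lmod F.
  (* Two negative modes have no central term; for two nonnegative ones it could occur only at
     [i = j = 0], where its factor [i] is zero. *)
  - move=> l m v' Hl Hm; rewrite Hc /kfield (negbTE (_ : _ != _)) ?scaler0 ?addr0 //.
    by lia.
  - move=> i j v'; rewrite Hc /kfield; case: eqP => [E|_]; last by rewrite scaler0 addr0.
    by have -> : i = 0%N by [lia]; rewrite mulr0z mulr0 scale0r addr0.
rewrite relator_cons lext_map_cons /= lext_sprod.
rewrite [X in sprod _ _ X](_ : _ = fun _ _ => 0).
  by rewrite sprod_zero //; apply: op_field.
by apply/funext => m; apply/funext => v'; rewrite IH.
Qed.

Definition vertex (u : weyl) (n : int) (v : weyl) : weyl :=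
  factor (wfield_relator n v) u.

Lemma vertex_w w n v : vertex (wcls F w) n v = wfield w n v.
Proof. exact: factor_w. Qed.

Lemma vertex_cls u n v : vertex (cls u) n v = lext (fun w => wfield w n v) u.
Proof. exact: factorE. Qed.

Lemma vertexD u1 u2 n v : vertex (u1 + u2) n v = vertex u1 n v + vertex u2 n v.
Proof. exact: linearD. Qed.
Lemma vertexZ c u n v : vertex (c *: u) n v = c *: vertex u n v.
Proof. exact: linearZ. Qed.
Lemma vertex0 n v : vertex 0 n v = 0.
Proof. exact: linear0. Qed.

Lemma vertex_field u : isfield (vertex u).
Proof.
have [u' ->] := cls_surj u.
rewrite [vertex _](_ : _ = fun n v => lext (fun w => wfield w n v) u').
  exact: lext_field wfield_field.
by apply/funext => n; apply/funext => v; rewrite vertex_cls.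
Qed.

Lemma vertex_vacuum : vertex vac = kfield 1.
Proof. by apply/funext => n; apply/funext => v; rewrite vertex_w. Qed.

Lemma vertex_op x a u : vertex (op x (- a.+1%:Z) u) = sprod a.+1 (op x) (vertex u) 0.
Proof.
have HX := op_field x.
apply/funext => n; apply/funext => v; elim/weyl_ind: u => [|c w u IH].
  rewrite op0 vertex0 [X in sprod _ _ X](_ : _ = fun _ _ => 0) ?sprod_zero //.
  by apply/funext => m; apply/funext => z; rewrite vertex0.
rewrite opD opZ vertexD vertexZ IH -wcls_cons vertex_w /=.
rewrite -sprodP //; try exact: wfield_field; try exact: vertex_field.
congr (sprod _ _ _ _ _ _); apply/funext => m; apply/funext => z.
by rewrite vertexD vertexZ vertex_w.
Qed.

Lemma csumE N p (f : nat -> weyl) : (forall j, (N <= j)%N -> f j = 0) ->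
  csum p f = \sum_(j < N) (ncoef p j)%:R *: f j.
Proof. by move=> H; apply: lsumE => j /H ->; rewrite scaler0. Qed.

(** The truncation in [prodw] loses nothing: beyond the bound the inner mode would produce a
    negative weight. *)
Lemma cls_prodw u n w : cls (prodw k u n w) = wfield u n (wcls F w).
Proof.
elim: u n w => [|[x a] u IH] n w.
  rewrite /= /kfield; case: ifP => _; last exact: cls_nil.
  by rewrite scale1r.
have Hlin m v : cls (linv (prodw k u m) v) = wfield u m (cls v).
  rewrite [LHS]cls_lext lext_linv [in RHS]cls_lext.
  elim: v => [|[c t] v IHv]; first by rewrite !lext_nil field0 //; apply: wfield_field.
  rewrite !lext_cons fieldD ?fieldZ ?IHv ?IH //; try exact: wfield_field.
  by rewrite -IH cls_lext.
rewrite prodw_cons cls_lext lext_flatten.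
set K := (wt _ + wt w + `|n|).+1.
have HK : K = (a.+1 + wt u + wt w + `|n|).+1 by rewrite /K wt_cons.
rewrite -[RHS]/(sprod a.+1 (op x) (wfield u) 0 n (wcls F w)) /sprod.
rewrite (@csumE K) => [|j Hj]; last first.
  by rewrite /pterm -IH prodw_weight0 ?op0 //; lia.
rewrite (@csumE K) => [|j Hj]; last first.
  by rewrite /mterm op_weight0 ?field0 //; [exact: wfield_field|lia].
rewrite -[iota 0 K]/(index_iota 0 K) big_mkord scaler_sumr -sumrB.
apply: eq_bigr => j _.
rewrite lext_scalev lext_cat lext_scalev -!cls_lext -op_cls Hlin IH -op_w.
rewrite /pterm /mterm !add0r addn1 !scalerA.
rewrite [LHS]scalerDr scalerA mulrN -scaleNr.
congr (_ *: _ + _).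
by congr (- _ *: _); rewrite mulrC.
Qed.

Lemma cls_nprod u n v : cls (nprod k u n v) = vertex (cls u) n (cls v).
Proof.
rewrite vertex_cls cls_lext lext_flatten; apply: eq_bigr => p _.
rewrite lext_flatten [cls v]cls_lext [RHS](_ : _ =
  p.1 *: lext (fun w => wfield p.2 n (wcls F w)) v).
  rewrite /lext scaler_sumr; apply: eq_bigr => q _.
  by rewrite -/(lext _ _) lext_scalev -cls_lext cls_prodw scalerA.
congr (_ *: _); elim: v => [|[c w] v IH].
  by rewrite !lext_nil field0 //; apply: wfield_field.
by rewrite !lext_cons fieldD ?fieldZ ?IH //; apply: wfield_field.
Qed.

Local Notation zfam := (fun (_ _ : int) (_ : weyl) => 0 : weyl).

Lemma commf_vertexP x c u w :
  commf (op x) (vertex (c *: u + w)) = fun l n v =>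
  c *: commf (op x) (vertex u) l n v + commf (op x) (vertex w) l n v.
Proof.
apply/funext => l; apply/funext => n; apply/funext => v.
by rewrite /commf !(vertexD, vertexZ) opD opZ; lmod F.
Qed.

Lemma commf_vertex0 x : commf (op x) (vertex 0) = zfam.
Proof.
apply/funext => l; apply/funext => n; apply/funext => v.
by rewrite /commf !vertex0 op0 subrr.
Qed.

Lemma commf_vacuum x : commf (op x) (vertex vac) = zfam.
Proof. rewrite vertex_vacuum; apply/funext => l; apply/funext => n; apply/funext => v.
by rewrite /commf /kfield; case: ifP => _; rewrite ?op0 ?subrr // opZ subrr. Qed.

(** The residue in [z1] of [(z1 - z2)^q [x(z1), Y(u, z2)]] is [Y(x(q)u, z2)]. When a letter
    [y(-a-1)] is added to [u], the derivation formula matches the commutation of [x(q)] past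
    [y(-a-1)] term by term. *)
Lemma vertex_mode u x (q : nat) n v :
  iter q (@delta F weyl) (commf (op x) (vertex u)) 0 n v = vertex (op x q%:Z u) n v.
Proof.
elim/(@weyl_spanned F k): u x q n v => [|c u IH|u w IHu IHw||y a u IH] x q n v.
- by rewrite commf_vertex0 iter_delta_zero op0 vertex0.
- rewrite -[c *: u]addr0 commf_vertexP iter_deltaP IH commf_vertex0.
  by rewrite iter_delta_zero !addr0 opZ vertexZ.
- rewrite -[u]scale1r commf_vertexP iter_deltaP IHu IHw opD opZ vertexD.
  by rewrite vertexZ.
- by rewrite commf_vacuum iter_delta_zero op_vacuum // vertex0.
have [[d z] [_ Hc]] := op_comm_kfield x y.
have HA := vertex_field u.
have HX := op_field x; have HY := op_field y; have HZ := op_field z.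
rewrite vertex_op (iter_delta_comm0 HX HY HZ Hc) // Hc !vertexD vertex_op !vertexZ.
congr (_ + _ *: _ + _).
- by congr (sprod _ _ _ _ _ _); apply/funext => m; apply/funext => w; rewrite IH.
(* For [q <= a] the exponent [a + 1 - q] is still positive and gives a creation mode; otherwise a
   commutator is left, and the induction hypothesis applies at [q - a - 1]. *)
- have [Hq|Hq] := ltnP q a.+1.
    rewrite iter_delta_sprod //; last exact: ltnW.
    have -> : q%:Z - a.+1%:Z = - (a - q).+1%:Z by lia.
    by rewrite vertex_op -subSn.
  rewrite iter_delta_sprod_ge // IH; congr (vertex (op z _ u) n v); lia.
rewrite /kfield (_ : (q%:Z - a.+1%:Z - 1 == -1) = (q == a.+1)); last by lia.
by case: ifP => _; rewrite ?vertex0 ?scaler0 // !vertexZ !scalerA; congr (_ *: _); ring.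
Qed.

Lemma vertex_local u x :
  exists L, iter L (@delta F weyl) (commf (op x) (vertex u)) = zfam.
Proof.
elim/(@weyl_spanned F k): u x => [|c u IH|u w IHu IHw||y a u IH] x.
- by exists 0%N; rewrite commf_vertex0.
- have [L HL] := IH x; exists L.
  rewrite -[c *: u]addr0 commf_vertexP iter_deltaP HL commf_vertex0 iter_delta_zero.
  by apply/funext => l; apply/funext => n; apply/funext => v; rewrite scaler0 addr0.
- have [L HL] := IHu x; have [M HM] := IHw x; exists (L + M)%N.
  rewrite -[u]scale1r commf_vertexP iter_deltaP.
  rewrite (iter_delta_le _ HL) ?leq_addr // (iter_delta_le _ HM) ?leq_addl //.
  by apply/funext => l; apply/funext => n; apply/funext => v; rewrite scaler0 addr0.
- by exists 0%N; rewrite commf_vacuum.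
have [[d z] [_ Hc]] := op_comm_kfield x y.
rewrite vertex_op.
exact: (locality_sprod (op_field x) (op_field y) (op_field z) Hc a.+1
  (vertex_field u) (IH x) (IH z)).
Qed.

Lemma vertex_commute x u : (forall q : nat, op x q%:Z u = 0) ->
  forall l n v, op x l (vertex u n v) = vertex u n (op x l v).
Proof.
move=> Hu l n v; apply/eqP; rewrite -subr_eq0 -[_ - _]/(commf (op x) (vertex u) l n v).
rewrite (iter_delta_eq0 (vertex_local u x)) // => q m w.
by rewrite vertex_mode Hu vertex0.
Qed.

End StateField.


(** * The commutant of the Heisenberg subalgebra *)

Section Commutant.
Variables (F : fieldType) (k : F).
Local Notation weyl := (weyl F).
Local Notation op := (op k).
Local Notation vac := (vacuum F).

Definition commutant (v : weyl) := forall m : nat, op Hb m%:Z v = 0.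

Lemma N0_cls v : N0 k v <-> commutant (cls v).
Proof.
by split=> H m; [rewrite op_cls -[RHS](cls_nil F)|];
  apply/clsP; rewrite -?[RHS](cls_nil F) // -op_cls H.
Qed.

Lemma cls_vac : cls (Defs.vac F) = vac.
Proof. by []. Qed.

Lemma commutant_vertex u n v : commutant u -> commutant v ->
  commutant (vertex k u n v).
Proof.
move=> Hu Hv m; rewrite vertex_commute // Hv field0 //.
exact: vertex_field.
Qed.

Lemma N0_vsubalg : vsubalg k (N0 k).
Proof.
split=> [|u v|c v|u v n|u v].
- by apply/N0_cls => m; rewrite cls_vac op_vacuum.
- by rewrite !N0_cls cls_cat => Hu Hv m; rewrite opD Hu Hv addr0.
- by rewrite !N0_cls cls_scale => Hv m; rewrite opZ Hv scaler0.
- by rewrite !N0_cls cls_nprod; apply: commutant_vertex.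
- by move=> /clsP E; rewrite !N0_cls E.
Qed.

Lemma generated_sub S P v : vsubalg k P -> (forall s, s \in S -> P s) ->
  generated k S v -> P v.
Proof. by move=> HP HS; apply. Qed.

Lemma generated_vsubalg S : vsubalg k (generated k S).
Proof.
split.
- by move=> P [].
- by move=> u v Hu Hv P HP HS; case: (HP) => _ HD _ _ _; apply: HD; [apply: Hu|apply: Hv].
- by move=> c v Hv P HP HS; case: (HP) => _ _ HZ _ _; apply: HZ; apply: Hv.
- by move=> u v n Hu Hv P HP HS; case: (HP) => _ _ _ HM _; apply: HM; [apply: Hu|apply: Hv].
- by move=> u v E Hu P HP HS; case: (HP) => _ _ _ _ HE; apply: HE E _; apply: Hu.
Qed.

Lemma op_weight_cls x n v : words_in (fun w => (wt w)%:Z < n) v -> op x n (cls v) = 0.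
Proof.
move=> Hv; rewrite cls_lext.
apply: (@words_in_lext _ (fun w => (wt w)%:Z < n) v _ _ (fun u => op x n u = 0)) => //.
- exact: op0.
- by move=> u w Hu Hw; rewrite opD Hu Hw addr0.
- by move=> c u Hu; rewrite opZ Hu scaler0.
- by move=> w; apply: op_weight0.
Qed.

(** By weight only the modes [m <= 2] can act nontrivially, and these are computed from [act]; for
    [W3] the bound is 3. *)
Lemma omega_commutant : commutant (cls (omega k)).
Proof.
move=> m; rewrite /omega cls_scale opZ.
have [Hm|Hm] := ltnP 2 m.
  rewrite op_weight_cls ?scaler0 //.
  by rewrite /words_in /= /wt /= !ltz_nat Hm !orbT.
rewrite op_cls.
case: m Hm => [|[|[|//]]] _; rewrite cls_lext /= !lext_cons lext_nil /=.
all: rewrite [X in _ *: X](_ : _ = 0) ?scaler0 //.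
all: lmod F.
Qed.

Lemma W3_commutant : commutant (cls (W3 k)).
Proof.
move=> m.
have [Hm|Hm] := ltnP 3 m.
  rewrite op_weight_cls //.
  by rewrite /words_in /= /wt /= !ltz_nat Hm !orbT.
rewrite op_cls.
case: m Hm => [|[|[|[|//]]]] _; rewrite cls_lext /= !lext_cons lext_nil /=.
all: lmod F.
Qed.

End Commutant.


(** * Creation property, translation, and quadratic fields *)

Section Creation.
Variables (F : fieldType) (k : F).
Local Notation weyl := (weyl F).
Local Notation op := (op k).
Local Notation vac := (vacuum F).
Local Notation vertex := (vertex k).

(** Since [u_m 1 = 0] for [m >= 0], the bound [-2 <= n] leaves the terms [j = 0, 1] of the first
    sum. It covers annihilation, creation ([n = -1]) and translation ([n = -2]) at once. *)
Lemma vertex_op_vacuum x a u (n : int) : -2 <= n ->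
  (forall m : nat, vertex u m%:Z vac = 0) ->
  vertex (op x (- a.+1%:Z) u) n vac =
  op x (- a.+1%:Z) (vertex u n vac) + a.+1%:R *: op x (- a.+2%:Z) (vertex u (n + 1) vac).
Proof.
move=> Hn Hu; rewrite vertex_op /sprod (@csumE _ 2) => [|j Hj]; last first.
  rewrite /pterm; have -> : n + j%:Z = (absz (n + j%:Z)%R)%:Z by lia.
  by rewrite Hu op0.
rewrite (@csumE _ 0) => [|j Hj]; last first.
  by rewrite /mterm op_vacuum // field0 //; apply: vertex_field.
rewrite big_ord0 scaler0 subr0 !big_ord_recl big_ord0 addr0 /pterm /=.
rewrite addn0 bin0 scale1r addr0 addn1 bin1; congr (_ + _ *: _).
all: by rewrite ?/bump /=; congr (op x _ (vertex _ _ _)); lia.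
Qed.

Lemma vertex_creation u :
  (forall m : nat, vertex u m%:Z vac = 0) /\ vertex u (-1) vac = u.
Proof.
elim/(@weyl_spanned F k): u => [|c u [H1 H2]|u w [H1 H2] [H3 H4]||x a u [H1 H2]].
- by split=> [m|]; rewrite vertex0.
- by split=> [m|]; rewrite vertexZ ?H1 ?H2 ?scaler0.
- by split=> [m|]; rewrite vertexD ?H1 ?H2 ?H3 ?H4 ?addr0.
- by split=> [m|]; rewrite vertex_vacuum /kfield /= ?scale1r.
split=> [m|]; rewrite vertex_op_vacuum //.
  by rewrite H1 -PoszD addn1 H1 !op0 scaler0 addr0.
by rewrite H2 addNr H1 op0 scaler0 addr0.
Qed.

(** The translation operator; in this form, stability under it follows from closure under products
    and the presence of the vacuum. *)
Definition transl u := vertex u (-2) vac.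

Lemma transl_vacuum : transl vac = 0.
Proof. by rewrite /transl vertex_vacuum. Qed.

Lemma transl_op x a u : transl (op x (- a.+1%:Z) u) =
  op x (- a.+1%:Z) (transl u) + a.+1%:R *: op x (- a.+2%:Z) u.
Proof.
have [H1 H2] := vertex_creation u.
have E : (-2 : int) + 1 = -1 by [].
by rewrite /transl vertex_op_vacuum // E H2.
Qed.

Lemma vertex_letter x n v : vertex (op x (-1) vac) n v = op x n v.
Proof.
rewrite -[-1]/(- 1%:Z) vertex_op vertex_vacuum /sprod expr1 scaleN1r opprK.
have [Hn|Hn] := ltP n 0.
  rewrite [X in _ + X](_ : _ = 0) ?addr0; last first.
    rewrite -[RHS](csum_zero weyl 1); apply: eq_csum => j.
    by rewrite /mterm /kfield (negbTE (_ : _ != _)) //; lia.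
  rewrite /csum (@lsum1 _ _ `|n|%N.-1) => [|j /eqP Hj].
    rewrite /pterm /kfield (_ : _ == _); last by lia.
    rewrite scale1r [ncoef _ _]/= add0n binn scale1r; congr (op x _ _); lia.
  by rewrite /pterm /kfield (negbTE (_ : _ != _)) ?op0 ?scaler0 //; lia.
rewrite [X in X + _](_ : _ = 0) ?add0r; last first.
  rewrite -[RHS](csum_zero weyl 1); apply: eq_csum => j.
  by rewrite /pterm /kfield (negbTE (_ : _ != _)) ?op0 //; lia.
rewrite /csum (@lsum1 _ _ `|n|%N) => [|j /eqP Hj].
  rewrite /mterm /kfield (_ : _ == _); last by lia.
  rewrite scale1r [ncoef _ _]/= add0n binn scale1r; congr (op x _ _); lia.
by rewrite /mterm /kfield (negbTE (_ : _ != _)) ?scaler0 //; lia.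
Qed.

Lemma vertex_quadratic x a y n v :
  vertex (op x (- a.+1%:Z) (op y (-1) vac)) n v =
  csum a.+1 (fun j => op x (- (a.+1 + j)%N%:Z) (op y (n + j%:Z) v))
  - (-1) ^+ a.+1 *: csum a.+1 (fun j => op y (n - (a.+1 + j)%N%:Z) (op x j%:Z v)).
Proof.
rewrite vertex_op /sprod; congr (_ - _ *: _); apply: eq_csum => j.
  by rewrite /pterm vertex_letter add0r.
by rewrite /mterm vertex_letter add0r.
Qed.
End Creation.

(** * Generation of the commutant *)

Section HeisenbergSpan.
Variables (F : fieldType) (k : F) (N : weyl F -> Prop).
Local Notation weyl := (weyl F).
Local Notation op := (op k).
Local Notation vac := (vacuum F).
Local Notation vertex := (vertex k).
Hypotheses (N_vac : N vac) (N_D : forall u v, N u -> N v -> N (u + v))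
  (N_Z : forall c v, N v -> N (c *: v))
  (N_vertex : forall u v n, N u -> N v -> N (vertex u n v))
  (N_com : forall v, N v -> commutant k v).

Inductive hspan : weyl -> Prop :=
| hspan_base w : N w -> hspan w
| hspan_op i v : hspan v -> hspan (op Hb (- i.+1%:Z) v)
| hspan_add u v : hspan u -> hspan v -> hspan (u + v).

Lemma N_0 : N 0.
Proof. by rewrite -(scale0r vac); apply: N_Z. Qed.

Lemma hspan0 : hspan 0.
Proof. exact: hspan_base N_0. Qed.

Lemma hspanZ c v : hspan v -> hspan (c *: v).
Proof.
elim=> [w Hw|i w _ IH|u w _ IHu _ IHw].
- by apply/hspan_base/N_Z.
- by rewrite -opZ; apply: hspan_op.
- by rewrite scalerDr; apply: hspan_add.
Qed.

Lemma hspanB u v : hspan u -> hspan v -> hspan (u - v).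
Proof. by move=> Hu Hv; rewrite -scaleN1r; apply: hspan_add => //; apply: hspanZ. Qed.

Lemma hspan_opH m v : hspan v -> hspan (op Hb m v).
Proof.
have [Hm|Hm] := ltP m 0.
  have -> : m = - (`|m|%N.-1).+1%:Z by lia.
  exact: hspan_op.
have -> : m = `|m|%N%:Z by lia.
elim=> [w Hw|i w Hw IH|u w _ IHu _ IHw].
- by rewrite (N_com Hw); apply: hspan0.
- rewrite op_comm /= big_nil addr0; apply: hspan_add; first exact: hspan_op.
  exact: hspanZ.
- by rewrite opD; apply: hspan_add.
Qed.

Lemma hspan_sum (I : Type) (s : seq I) (P : pred I) (f : I -> weyl) :
  (forall i, P i -> hspan (f i)) -> hspan (\sum_(i <- s | P i) f i).
Proof.
by move=> H; elim/big_rec: _ => [|i u Pi Hu]; [apply: hspan0|apply: hspan_add => //; apply: H].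
Qed.

Lemma hspan_lsum f : (forall j, hspan (f j)) -> hspan (lsum f).
Proof.
move=> H; rewrite /lsum; case: pselect => [?|?]; last exact: hspan0.
by apply: hspan_sum.
Qed.

Lemma hspan_csum p f : (forall j, hspan (f j)) -> hspan (csum p f).
Proof. by move=> H; apply: hspan_lsum => j; apply: hspanZ. Qed.

(** Fields of [N] commute with every [h(l)], so they pass through the Heisenberg letters and act on
    the factor in [N]. *)
Lemma hspan_vertexN u n v : N u -> hspan v -> hspan (vertex u n v).
Proof.
move=> Hu; elim=> [w Hw|i w _ IH|v1 v2 _ IH1 _ IH2].
- exact/hspan_base/N_vertex.
- by rewrite -(vertex_commute (N_com Hu)); apply: hspan_op.
- by rewrite fieldD; [apply: hspan_add|apply: vertex_field].
Qed.

Lemma hspan_vertex u n v : hspan u -> hspan v -> hspan (vertex u n v).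
Proof.
move=> Hu; elim: Hu n v => [w Hw|i w _ IH|u1 u2 _ IH1 _ IH2] n v Hv.
- exact: hspan_vertexN.
- rewrite vertex_op; apply: hspanB; last apply: hspanZ; apply: hspan_csum => j.
    by apply: hspan_opH; apply: IH.
  by apply: IH; apply: hspan_opH.
- by rewrite vertexD; apply: hspan_add; [apply: IH1|apply: IH2].
Qed.

Lemma hspan_transl u : hspan u -> hspan (transl k u).
Proof. by move=> Hu; apply: hspan_vertex => //; apply: hspan_base. Qed.

Hypothesis char0 : forall n : nat, n.+1%:R != 0 :> F.
Hypothesis k_neq0 : k != 0.

(** [M] bounds the Heisenberg modes, which makes the degree operator a finite sum; [n] merely bounds
    their number, so that vectors of different degrees can be added. *)
Inductive hdeg (M : nat) : nat -> weyl -> Prop :=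
| hdeg_base n w : N w -> hdeg M n w
| hdeg_op n i v : (i < M)%N -> hdeg M n v -> hdeg M n.+1 (op Hb (- i.+1%:Z) v)
| hdeg_add n u v : hdeg M n u -> hdeg M n v -> hdeg M n (u + v).

Lemma hdeg_le M n M' n' v : (M <= M')%N -> (n <= n')%N -> hdeg M n v -> hdeg M' n' v.
Proof.
move=> HM Hn H; elim: H n' Hn => {n v} [n w Hw|n i w Hi _ IH|n u w _ IHu _ IHw] n' Hn.
- exact: hdeg_base.
- case: n' Hn => // n' Hn; apply: hdeg_op; last exact: IH.
  exact: leq_trans HM.
- by apply: hdeg_add; [apply: IHu|apply: IHw].
Qed.

Lemma hspan_hdeg v : hspan v -> exists M n, hdeg M n v.
Proof.
elim=> [w Hw|i w _ [M [n H]]|u w _ [M [n H]] _ [M' [n' H']]].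
- by exists 0%N, 0%N; apply: hdeg_base.
- exists (maxn M i.+1), n.+1; apply: hdeg_op; first exact: leq_maxr.
  by apply: hdeg_le H; rewrite ?leq_maxl.
- exists (maxn M M'), (maxn n n'); apply: hdeg_add.
    by apply: hdeg_le H; rewrite leq_maxl.
  by apply: hdeg_le H'; rewrite leq_maxr.
Qed.

Lemma hdegZ M n c v : hdeg M n v -> hdeg M n (c *: v).
Proof.
elim=> {n v} [n w Hw|n i w Hi _ IH|n u w _ IHu _ IHw].
- by apply/hdeg_base/N_Z.
- by rewrite -opZ; apply: hdeg_op.
- by rewrite scalerDr; apply: hdeg_add.
Qed.

(* The degree operator: h(-i1) ... h(-ip) w, with w in N, is an eigenvector
   of eigenvalue p. *)
Definition hdegree M v : weyl :=
  \sum_(i < M) (2%:R * i.+1%:R * k)^-1 *: op Hb (- i.+1%:Z) (op Hb i.+1%:Z v).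

Lemma hdegreeD M u v : hdegree M (u + v) = hdegree M u + hdegree M v.
Proof.
by rewrite /hdegree -big_split; apply: eq_bigr => i _; rewrite !opD scalerDr.
Qed.

Lemma hdegree_com M v : commutant k v -> hdegree M v = 0.
Proof. by move=> Hv; rewrite /hdegree big1 // => i _; rewrite Hv op0 scaler0. Qed.

(** [h(-i-1)] commutes with every summand except the one of index [i], where the commutator
    [2(i+1)k] cancels the normalising factor. *)
Lemma hdegree_op M i v : (i < M)%N ->
  hdegree M (op Hb (- i.+1%:Z) v) = op Hb (- i.+1%:Z) (hdegree M v + v).
Proof.
move=> Hi; rewrite /hdegree opD op_sum.
rewrite (bigD1 (Ordinal Hi)) //= [in RHS](bigD1 (Ordinal Hi)) //=.
have E (j : 'I_M) : (2%:R * j.+1%:R * k)^-1 *: op Hb (- j.+1%:Z)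
      (op Hb j.+1%:Z (op Hb (- i.+1%:Z) v)) =
    op Hb (- i.+1%:Z) ((2%:R * j.+1%:R * k)^-1 *:
      op Hb (- j.+1%:Z) (op Hb j.+1%:Z v))
    + (if j == Ordinal Hi then op Hb (- i.+1%:Z) v else 0).
  rewrite [op Hb j.+1%:Z (op Hb (- i.+1%:Z) _)]op_comm /= big_nil addr0 opD opZ scalerDr scalerA opZ.
  rewrite [op Hb (- i.+1%:Z) (op Hb (- j.+1%:Z) _)]op_comm /= big_nil addr0.
  rewrite [central k Hb Hb (- i.+1%:Z) _](_ : _ = 0); last first.
    by rewrite /central (negbTE (_ : _ != _)) //; lia.
  rewrite scale0r addr0; congr (_ + _); rewrite /central /= subr_eq0.
  rewrite (_ : (j.+1%:Z == i.+1%:Z) = (j == Ordinal Hi)); last first.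
    by rewrite -val_eqE /= eqz_nat eqSS.
  case: eqP => [->|_]; last by rewrite mulr0 scale0r.
  rewrite /= (_ : _ * _ = 1) ?scale1r //.
  rewrite -[i.+1%:Z%:~R]/(i.+1%:R : F) [i.+1%:R * _]mulrC mulVf //.
  by rewrite !mulf_neq0 // (char0 1).
have := E (Ordinal Hi); rewrite /= eqxx => ->; have -> : \sum_(j < M | j != Ordinal Hi) (2%:R * j.+1%:R * k)^-1 *:
    op Hb (- j.+1%:Z) (op Hb j.+1%:Z (op Hb (- i.+1%:Z) v)) =
    \sum_(j < M | j != Ordinal Hi) op Hb (- i.+1%:Z) ((2%:R * j.+1%:R * k)^-1 *:
      op Hb (- j.+1%:Z) (op Hb j.+1%:Z v)).
  by apply: eq_bigr => j /negbTE Hj; rewrite E Hj addr0.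
by rewrite addrAC.
Qed.

(** The eigenvalues that occur are at most [n + 1], and subtracting [n + 1] from the degree operator
    removes the top one. *)
Lemma hdeg_lower M n v : hdeg M n.+1 v -> hdeg M n (hdegree M v - n.+1%:R *: v).
Proof.
move: {-2}n.+1 (erefl n.+1) => n' En H.
elim: H n En => {n' v} [n' w Hw|n' i w Hi Hw IH|n' u w _ IHu _ IHw] n En.
- by rewrite hdegree_com ?add0r -?scaleNr; [apply/hdeg_base/N_Z|apply: N_com].
- rewrite hdegree_op //; case: En => En; subst n'.
  have -> : op Hb (- i.+1%:Z) (hdegree M w + w) - n.+1%:R *: op Hb (- i.+1%:Z) w
      = op Hb (- i.+1%:Z) (hdegree M w - n%:R *: w).
    by rewrite opD [in RHS]opD opN opZ -natr1; lmod F.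
  (* For [n = 0] there is no smaller degree to descend to; but then [w] is a sum of elements of [N],
     and the degree operator kills it. *)
  case: n Hw IH => [|n] Hw IH; last by apply: hdeg_op => //; apply: IH.
  suff -> : hdegree M w = 0 by rewrite scale0r subrr op0; apply/hdeg_base/N_0.
  move: {-2}0%N (erefl 0%N) Hw {IH} => z Ez H.
  elim: H Ez => // [m u Hu _|m u1 u2 _ IH1 _ IH2 Ez].
    by apply/hdegree_com/N_com.
  by rewrite hdegreeD IH1 ?IH2 // addr0.
- rewrite hdegreeD scalerDr opprD addrACA.
  by apply: hdeg_add; [apply: IHu|apply: IHw].
Qed.

Lemma hdeg0 M v : hdeg M 0 v -> N v.
Proof.
move: {-2}0%N (erefl 0%N) => z Ez H.
elim: H Ez => // m u1 u2 _ IH1 _ IH2 Ez.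
by apply: N_D; [apply: IH1|apply: IH2].
Qed.

(** The degree operator vanishes on the commutant, so [hdeg_lower] returns [-(n+1) v] itself with a
    smaller bound, and characteristic 0 allows the division. *)
Lemma hspan_commutant v : hspan v -> commutant k v -> N v.
Proof.
move=> /hspan_hdeg [M [n H]] Hv; elim: n H => [|n IH]; first exact: hdeg0.
move/hdeg_lower; rewrite hdegree_com // add0r -scaleNr => /(hdegZ (- n.+1%:R)^-1).
by rewrite scalerA mulVf ?oppr_eq0 // scale1r.
Qed.

End HeisenbergSpan.


(** * From omega and W^3 to all words of charge zero *)

Section Generation.
Variables (F : fieldType) (k : F) (N : weyl F -> Prop).
Local Notation weyl := (weyl F).
Local Notation op := (op k).
Local Notation vac := (vacuum F).
Local Notation vertex := (vertex k).
Local Notation G := (hspan k N).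
Hypotheses (N_vac : N vac) (N_D : forall u v, N u -> N v -> N (u + v))
  (N_Z : forall c v, N v -> N (c *: v))
  (N_vertex : forall u v n, N u -> N v -> N (vertex u n v))
  (N_com : forall v, N v -> commutant k v).
Hypothesis char0 : forall n : nat, n.+1%:R != 0 :> F.

Let G0 : G 0 := hspan0 k N_vac N_Z.
Let GD u v : G u -> G v -> G (u + v) := @hspan_add F k N u v.
Let GZ c v : G v -> G (c *: v) := hspanZ N_Z c (v := v).
Let GB u v : G u -> G v -> G (u - v) := hspanB N_Z (u := u) (v := v).
Let GH m v : G v -> G (op Hb m v) := hspan_opH N_vac N_Z N_com m (v := v).
Let GY u n v : G u -> G v -> G (vertex u n v) :=
  hspan_vertex N_vac N_Z N_vertex N_com (u := u) n (v := v).
Let GT u : G u -> G (transl k u) :=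
  hspan_transl N_vac N_Z N_vertex N_com (u := u).
Let Gvac : G vac := hspan_base k N_vac.

Lemma G_cancel c u : c != 0 -> G (c *: u) -> G u.
Proof. by move=> Hc /(GZ c^-1); rewrite scalerA mulVf // scale1r. Qed.

Definition ef a b : weyl := op Eb (- a.+1%:Z) (op Fb (- b.+1%:Z) vac).

Lemma transl_ef a b :
  transl k (ef a b) = b.+1%:R *: ef a b.+1 + a.+1%:R *: ef a.+1 b.
Proof. by rewrite /ef !transl_op transl_vacuum op0 add0r opZ. Qed.

Lemma op_commHE l m v : op Eb l (op Hb m v) =
  op Hb m (op Eb l v) - 2%:R *: op Eb (l + m) v.
Proof.
rewrite op_comm /= big_cons big_nil addr0 /central /=.
by rewrite mulr0 mul0r if_same scale0r addr0 scaleNr.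
Qed.

Lemma op_commHF l m v : op Fb l (op Hb m v) =
  op Hb m (op Fb l v) + 2%:R *: op Fb (l + m) v.
Proof.
rewrite op_comm /= big_cons big_nil addr0 /central /=.
by rewrite mulr0 mul0r if_same scale0r addr0.
Qed.

Lemma op_commEE l m v : op Eb l (op Eb m v) = op Eb m (op Eb l v).
Proof.
by rewrite op_comm /= big_nil addr0 /central /= mulr0 mul0r if_same scale0r addr0.
Qed.

Lemma op_commFF l m v : op Fb l (op Fb m v) = op Fb m (op Fb l v).
Proof.
by rewrite op_comm /= big_nil addr0 /central /= mulr0 mul0r if_same scale0r addr0.
Qed.

Lemma op_commFE l m v : op Fb l (op Eb m v) =
  op Eb m (op Fb l v) - op Hb (l + m) v
  + (if l + m == 0 then l%:~R * k else 0) *: v.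
Proof.
rewrite op_comm /= big_cons big_nil addr0 /central /= mulr1.
by rewrite scaleN1r.
Qed.

Lemma op_commEF l m v : op Eb l (op Fb m v) =
  op Fb m (op Eb l v) + op Hb (l + m) v
  + (if l + m == 0 then l%:~R * k else 0) *: v.
Proof. by rewrite op_comm /= big_cons big_nil addr0 /central /= mulr1 scale1r. Qed.

Section Recursion.
Variable a : nat.
Local Notation f := (op Fb (-1) vac).
Local Notation v := (ef a.+1 0).

Lemma opE_f (j : nat) : op Eb j%:Z f =
  if j == 0%N then op Hb (-1) vac else if j == 1%N then k *: vac else 0.
Proof.
rewrite op_commEF op_vacuum // op0 add0r.
case: j => [|[|j]] /=.
- by rewrite scale0r addr0.
- by rewrite op_vacuum // add0r mul1r.
- by rewrite op_vacuum // add0r scale0r.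
Qed.

Lemma opF_v (j : nat) : op Fb (1 + j%:Z) v =
  (if j == a.+1 then (j.+1%:R * k) *: f else 0) - op Hb (j%:Z - a.+1%:Z) f.
Proof.
rewrite /ef op_commFE op_commFF op_vacuum // !op0 sub0r addrC.
rewrite (_ : 1 + j%:Z + - a.+2%:Z = j%:Z - a.+1%:Z); last by lia.
rewrite subr_eq0 eqz_nat; case: ifP => _; last by rewrite scale0r.
by rewrite -[(1 + j%:Z)%:~R]/(j.+1%:R).
Qed.

Let ef_step_sum : weyl :=
  \sum_(j < a.+1) j.+1%:R *: op Hb (j%:Z - a.+1%:Z) (ef j.+1 0).

Lemma sum_twice_succ n : \sum_(j < n) (2%:R * j.+1%:R) = (n%:R * n.+1%:R : F).
Proof.
elim: n => [|n IH]; first by rewrite big_ord0 mul0r.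
by rewrite big_ord_recr /= IH -!natrM -natrD; congr (_%:R); lia.
Qed.

(** A term [j <= a] yields a negative mode of [h]; moving [e] past it contributes [2(j+1)], in total
    [(a+1)(a+2)]. The term [j = a + 1] meets the central term and [h(0)f = -2f], whence the other
    part of the coefficient. *)
Lemma ef_step_first :
  csum 2 (fun j => op Eb (- (2 + j)%N%:Z) (op Fb (1 + j%:Z) v)) =
  (a.+1%:R * a.+2%:R + a.+2%:R * (2%:R + a.+2%:R * k)) *: ef a.+2 0 - ef_step_sum.
Proof.
rewrite (@csumE _ a.+2) => [|j Hj]; last first.
  rewrite opF_v gtn_eqF // sub0r opN.
  have -> : j%:Z - a.+1%:Z = (j - a.+1)%N%:Z by lia.
  rewrite [op Hb _ f]op_comm /= big_cons big_nil addr0 [op Hb _ vac]op_vacuum // op0 add0r.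
  rewrite [op Fb _ vac]op_vacuum /=; last by lia.
  by rewrite /central /= mulr0 mul0r if_same ?scale0r ?scaler0 ?addr0 ?op0 ?oppr0 ?op0 ?scaler0.
rewrite big_ord_recr /= opF_v eqxx addrN.
have -> : op Hb 0 f = - 2%:R *: f.
  rewrite [op Hb _ f]op_comm /= big_cons big_nil addr0 [op Hb _ vac]op_vacuum // op0 !add0r.
  by rewrite /central /= scale0r addr0.
rewrite opD opN !opZ -/(ef a.+2 0) add1n binSn.
rewrite (eq_bigr (fun j : 'I_a.+1 => (2%:R * j.+1%:R) *: ef a.+2 0
   - j.+1%:R *: op Hb (j%:Z - a.+1%:Z) (ef j.+1 0))) => [|j _]; last first.
  rewrite opF_v ltn_eqF ?ltn_ord // sub0r opN op_commHE add1n binSn.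
  rewrite (_ : - (2 + j)%N%:Z + (j%:Z - a.+1%:Z) = - a.+3%:Z); last by lia.
  by rewrite -!/(ef _ 0); lmod F.
rewrite sumrB -scaler_suml sum_twice_succ -/ef_step_sum.
by lmod F.
Qed.

(** [e(j)] passes [e(-a-2)] freely and meets [f(-1)1], on which only [j = 0] and [j = 1] act. *)
Lemma ef_step_second :
  csum 2 (fun j => op Fb (1 - (2 + j)%N%:Z) (op Eb j%:Z v)) =
  op Hb (-1) (ef a.+1 0) - op Hb (-1) (op Hb (- a.+3%:Z) vac)
  + (2%:R + 2%:R * k) *: ef a.+1 1 - 2%:R *: ef a.+2 0
  - (2%:R * k) *: op Hb (- a.+4%:Z) vac.
Proof.
have E j : op Eb j%:Z v = op Eb (- a.+2%:Z) (op Eb j%:Z f) by apply: op_commEE.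
rewrite (@csumE _ 2) => [|j Hj]; last first.
  by rewrite E opE_f; case: j Hj => [|[|j]] //= _; rewrite !op0.
have FE l m : l < 0 -> m < 0 ->
    op Fb l (op Eb m vac) = op Eb m (op Fb l vac) - op Hb (l + m) vac.
  move=> Hl Hm; rewrite op_commFE (negbTE (_ : l + m != 0)); last by lia.
  by rewrite scale0r addr0.
rewrite !big_ord_recl big_ord0 addr0 !E !opE_f /= !opZ.
rewrite op_commHE opD opN opZ op_commHF !FE //.
have E1 : 1 - (2 + 0)%N%:Z = -1 by [].
have E2 : 1 - (2 + bump 0 0)%N%:Z = -2 by [].
have E3 : (-1 : int) - 1 = -2 by [].
have E4 : 'C(1 + 0, 0)%N = 1%N by [].
have E5 : 'C(1 + bump 0 0, bump 0 0)%N = 2%N by [].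
have E6 : -1 - a.+2%:Z = - a.+3%:Z by lia.
have E7 : - a.+2%:Z - 1 = - a.+3%:Z by lia.
have E8 : -1 - a.+3%:Z = - a.+4%:Z by lia.
have E9 : -2 - a.+2%:Z = - a.+4%:Z by lia.
rewrite !(E1, E2, E3, E4, E5, E6, E7, E8, E9) opD opN.
by rewrite -!/(ef _ _); lmod F.
Qed.

Lemma ef_step : k * a.+2%:R + a.+3%:R != 0 -> G (ef 1 0) ->
  (forall b, (b <= a)%N -> G (ef b.+1 0)) -> G (ef a.+2 0).
Proof.
move=> Hk G1 Hlow.
have Ga : G v by apply: Hlow.
(* The coefficient collects [(a+2)(k(a+2)+a+3)] from the first sum, [2] from the second, and
   [(2+2k)(a+2)] from trading [ef a.+1 1] for the translate of [ef a.+1 0]. *)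
have : G ((a.+4%:R * (k * a.+2%:R + a.+3%:R)) *: ef a.+2 0).
  rewrite [_ *: _](_ : _ = vertex (ef 1 0) 1 v + ef_step_sum
    + op Hb (-1) (ef a.+1 0) - op Hb (-1) (op Hb (- a.+3%:Z) vac)
    + (2%:R + 2%:R * k) *: transl k v - (2%:R * k) *: op Hb (- a.+4%:Z) vac); last first.
    rewrite [ef 1 0]/ef vertex_quadratic ef_step_first ef_step_second transl_ef.
    by rewrite sqrrN expr1n; lmod F.
  apply: GB; last exact/GZ/GH.
  apply: GD; last exact/GZ/GT.
  apply: GB; last exact/GH/GH.
  apply: GD; last exact/GH.
  apply: GD; first exact: GY.
  apply: (hspan_sum N_vac N_Z) => j _; apply/GZ/GH/Hlow.
  by rewrite -ltnS.
by apply: G_cancel; rewrite mulf_neq0.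
Qed.
End Recursion.


Hypotheses (N_omega : N (cls (omega k))) (N_W3 : N (cls (W3 k))).
Hypotheses (k_neq0 : k != 0) (k2_neq0 : k + 2%:R != 0)
  (k_generic : forall a, k * a.+2%:R + a.+3%:R != 0).

Let two_neq0 : 2%:R != 0 :> F. Proof. exact: char0 1. Qed.

Lemma ef00 : G (ef 0 0).
Proof.
have : G (cls (omega k)) by apply: hspan_base.
rewrite /omega cls_scale => /G_cancel; rewrite invr_eq0 !mulf_neq0 //.
move=> /(_ isT); set L := (X in cls X) => HL.
apply: (@G_cancel (2%:R * k)); first by rewrite mulf_neq0.
rewrite [_ *: _](_ : _ = cls L + k *: op Hb (- 2%:Z) vac
  + op Hb (- 1%:Z) (op Hb (- 1%:Z) vac)); last first.
  by rewrite cls_lext !lext_cons lext_nil /= !(wcls_cons k); lmod F.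
by apply: GD; [apply: GD => //; apply/GZ/GH|apply/GH/GH].
Qed.

(** Translating [ef 0 0] gives the sum of the two vectors; modulo Heisenberg words and [h(-1)]
    applied to [ef 0 0], [W3] gives a multiple of their difference. *)
Lemma ef_weight3 : G (ef 1 0) /\ G (ef 0 1).
Proof.
have three_neq0 : 3%:R != 0 :> F by exact: char0 2.
have H1 : G (1%:R *: ef 0 1 + 1%:R *: ef 1 0).
  by rewrite -transl_ef; apply/GT/ef00.
have H2 : G (ef 1 0 - ef 0 1).
  have : G (cls (W3 k)) by apply: hspan_base.
  set L := W3 k => HL; apply: (@G_cancel (3%:R * k ^+ 2)).
    by rewrite !mulf_neq0.
  rewrite [_ *: _](_ : _ = cls L - k ^+ 2 *: op Hb (- 3%:Z) vac
    - (3%:R * k) *: op Hb (- 2%:Z) (op Hb (- 1%:Z) vac)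
    - 2%:R *: op Hb (- 1%:Z) (op Hb (- 1%:Z) (op Hb (- 1%:Z) vac))
    + (6%:R * k) *: op Hb (- 1%:Z) (ef 0 0)); last first.
    by rewrite cls_lext /L /W3 !lext_cons lext_nil /= !(wcls_cons k); lmod F.
  apply: GD; last by apply/GZ/GH/ef00.
  by apply: GB; last (by apply/GZ/GH/GH/GH); apply: GB; last (by apply/GZ/GH/GH);
    apply: GB => //; apply/GZ/GH.
split; apply: (@G_cancel 2%:R) => //.
  by rewrite [_ *: _](_ : _ = (1%:R *: ef 0 1 + 1%:R *: ef 1 0)
    + (ef 1 0 - ef 0 1)); [exact: GD|lmod F].
by rewrite [_ *: _](_ : _ = (1%:R *: ef 0 1 + 1%:R *: ef 1 0)
    - (ef 1 0 - ef 0 1)); [exact: GB|lmod F].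
Qed.

(** Within one weight, translation trades [b] for [a], so only [ef a 0] is new at each weight;
    [ef 1 0] starts the recursion [ef_step]. *)
Lemma ef_G a b : G (ef a b).
Proof.
suff H m : forall n a b, (n <= m)%N -> (a + b)%N = n -> G (ef a b) 
  by exact: (H _ _ a b (leqnn _) erefl).
elim: m => [|m IH] n {}a {}b.
  by rewrite leqn0 => /eqP -> /eqP; rewrite addn_eq0 => /andP [/eqP -> /eqP ->]; apply: ef00.
rewrite leq_eqVlt ltnS => /orP [/eqP -> {n}|]; last exact: IH.
elim: b a => [|b IHb] a.
  rewrite addn0 => ->; case: m IH => [|m] IH; first by case: ef_weight3.
  apply: ef_step => //; first by case: ef_weight3.
  by move=> b Hb; apply: (IH b.+1); rewrite ?addn0.
move=> Hab; apply: (@G_cancel b.+1%:R) => //.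
have E := transl_ef a b.
rewrite [_ *: _](_ : _ = transl k (ef a b) - a.+1%:R *: ef a.+1 b); last first.
  by rewrite E; lmod F.
apply: GB.
  by apply/GT/(IH (a + b)%N) => //; lia.
by apply/GZ/IHb; lia.
Qed.

Lemma swap_words u t x a y b :
  wcls F (u ++ (x, a) :: (y, b) :: t) = wcls F (u ++ (y, b) :: (x, a) :: t)
  + \sum_(cz <- br F x y) cz.1 *: wcls F (u ++ (cz.2, (a + b).+1) :: t).
Proof.
have := wcls_relator F u t x a y b; rewrite lext_relator => /eqP.
by rewrite subr_eq0 subr_eq addrC => /eqP.
Qed.

Lemma br_charge x y cz : cz \in br F x y -> charge1 cz.2 = charge1 x + charge1 y.
Proof. by case: x; case: y => //=; rewrite inE => /eqP ->. Qed.

Section MoveFront.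
Variable n : nat.
Hypothesis IHn : forall w, (size w < n)%N -> charge w = 0 -> G (wcls F w).

(** Letters commute up to shorter words of the same charge, which lie in [G] by [IHn]. *)
Lemma G_move_front p l u t : (size (p ++ l :: u ++ t) <= n)%N ->
  charge (p ++ l :: u ++ t) = 0 -> G (wcls F (p ++ l :: u ++ t)) ->
  G (wcls F (p ++ u ++ l :: t)).
Proof.
case: l => x a; elim: u p => [|[y b] u IH] p //= Hs Hc HG.
rewrite -cat_rcons; apply: IH; rewrite cat_rcons.
- by move: Hs; rewrite !size_cat.
- by move: Hc; rewrite !charge_cat !charge_cons charge_cat; lia.
rewrite swap_words; apply: GD => //; rewrite big_seq.
apply: (hspan_sum N_vac N_Z) => cz Hcz; apply/GZ/IHn.
  by move: Hs; rewrite !size_cat /= !size_cat /=; lia.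
by move: Hc; rewrite !charge_cat !charge_cons charge_cat /= (br_charge Hcz); lia.
Qed.

Lemma G_op_op y p x (m : nat) w : charge1 y + charge1 x + charge w = 0 ->
  ((size w).+1 < n)%N -> G (op y (- p.+1%:Z) (op x m%:Z (wcls F w))).
Proof.
move=> Hc Hs; rewrite op_w cls_lext [op y _ _](_ : _ =
  lext (fun t => wcls F ((y, p) :: t)) (act k x m w)); last first.
  elim: (act k x m w) => [|[c t] u IH]; first by rewrite !lext_nil op0.
  by rewrite !lext_cons opD opZ IH (wcls_cons k).
apply: (words_in_lext G0 GD GZ _ (act_words k x m w)) => t /and3P [_ /eqP Ht Hsz].
apply: IHn.
  by apply: leq_ltn_trans Hs; rewrite ltnS; apply: Hsz.
by rewrite charge_cons Ht addrA.
Qed.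

(** The field of [e(-a-1)f(-1)1] in mode [-b-1] has the wanted vector as leading term. In every
    other term either a mode annihilates, which leaves shorter words, or the mode of [f] is closer
    to zero, which the inner induction covers. *)
Lemma G_ef_word a b w : charge w = 0 -> ((size w).+1 < n)%N ->
  G (op Eb (- a.+1%:Z) (op Fb (- b.+1%:Z) (wcls F w))).
Proof.
move=> Hc Hs; elim/ltn_ind: b a => b IHb a.
have Gw : G (wcls F w) by apply: IHn => //; lia.
have := GY (- b.+1%:Z) (ef_G a 0) Gw; rewrite [ef a 0]/ef vertex_quadratic.
set P := csum _ _; set M := csum _ _ => HPM.
have HM : G M.
  apply: (hspan_csum N_vac N_Z) => j.
  have -> : - b.+1%:Z - (a.+1 + j)%N%:Z = - (b.+1 + a + j)%N.+1%:Z by lia.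
  by apply: G_op_op => //; rewrite Hc.
have : G P.
  by rewrite -(subrK ((-1) ^+ a.+1 *: M) P); apply: GD => //; apply: GZ.
set T := op Eb _ _.
pose R := lsum (fun j => (ncoef a.+1 j.+1)%:R *:
  op Eb (- (a.+1 + j.+1)%N%:Z) (op Fb (- b.+1%:Z + j.+1%:Z) (wcls F w))).
have -> : P = T + R.
  rewrite /P /csum lsum_recl ?ncoef_0r ?scale1r.
    by congr (op Eb _ (op Fb _ _) + _); lia.
  apply: fsuppZ; have [K HK] := (op_field k Fb).2 (wcls F w).
  by exists (K + b.+1)%N => j Hj; rewrite HK ?op0 //; lia.
suff HR : G R by rewrite -{2}(addrK R T) => H; apply: GB.
apply: (hspan_lsum N_vac N_Z) => j; apply: GZ.
have -> : - (a.+1 + j.+1)%N%:Z = - (a.+1 + j).+1%:Z by lia.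
(* The mode here is [f(-b+j)], a creation mode exactly when [j < b]. *)
have [Hj|Hj] := ltnP j b.
  have -> : - b.+1%:Z + j.+1%:Z = - (b - j.+1).+1%:Z by lia.
  by apply: IHb; lia.
have -> : - b.+1%:Z + j.+1%:Z = (j - b)%N%:Z by lia.
by apply: G_op_op => //; rewrite Hc.
Qed.
End MoveFront.

Lemma charge_letters w : Hb \notin [seq l.1 | l <- w] ->
  Fb \notin [seq l.1 | l <- w] -> charge w = (size w)%:Z.
Proof.
elim: w => [|[x a] w IH]; first by rewrite /charge big_nil.
rewrite /= !inE !negb_or => /andP [Hx /IH{}IH] /andP [Hx' /IH Hw].
by rewrite charge_cons Hw; case: x Hx Hx' => //= _ _; lia.
Qed.

Lemma charge_letters_neg w : Hb \notin [seq l.1 | l <- w] ->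
  Eb \notin [seq l.1 | l <- w] -> charge w = - (size w)%:Z.
Proof.
elim: w => [|[x a] w IH]; first by rewrite /charge big_nil.
rewrite /= !inE !negb_or => /andP [Hx /IH{}IH] /andP [Hx' /IH Hw].
by rewrite charge_cons Hw; case: x Hx Hx' => //= _ _; lia.
Qed.

Lemma split_letter x (w : word) : x \in [seq l.1 | l <- w] ->
  exists u a t, w = u ++ (x, a) :: t.
Proof.
case/mapP=> -[y a] /= Hw ->; case/splitPr: Hw => u t; by exists u, a, t.
Qed.

(** An [h] can be moved to the front and stripped. Without [h], a nonempty word of charge 0 contains
    both an [e] and an [f]; moved to the front, they fall under [G_ef_word]. *)
Lemma G_charge0 w : charge w = 0 -> G (wcls F w).
Proof.
have [n] := ubnP (size w); elim: n w => // n IHn w; rewrite ltnS => Hs Hc.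
have [/split_letter [u [a [t Ew]]]|Hh] := boolP (Hb \in [seq l.1 | l <- w]).
  subst w; apply: (G_move_front IHn (p := [::])) => /=.
  - by move: Hs; rewrite !size_cat /=; lia.
  - by move: Hc; rewrite !charge_cat !charge_cons charge_cat; lia.
  rewrite (wcls_cons k); apply/GH/IHn.
    by move: Hs; rewrite !size_cat /=; lia.
  by move: Hc; rewrite !charge_cat !charge_cons /=; lia.
have [/split_letter [u [b [t Ew]]]|Hf] := boolP (Fb \in [seq l.1 | l <- w]); last first.
  move: Hc; rewrite charge_letters //; case: (w) => [|l w'] //=.
have [He|He] := boolP (Eb \in [seq l.1 | l <- u ++ t]); last first.
  move: Hc; rewrite Ew charge_cat charge_cons addrCA -charge_cat charge_letters_neg //.
    by rewrite /=; lia.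
  move: Hh; rewrite Ew !map_cat !mem_cat /= inE !negb_or.
  by case/andP=> -> /andP [_ ->].
subst w; apply: (G_move_front IHn (p := [::])) => /=.
- by move: Hs; rewrite !size_cat /=; lia.
- by move: Hc; rewrite !charge_cat !charge_cons charge_cat; lia.
case/split_letter: He => u' [a [t' E]]; rewrite E.
have Hs' : (@size letter (u' ++ t')).+2 = @size letter (u ++ (Fb, b) :: t).
  by have := congr1 (@size letter) E; rewrite !(@size_cat letter) /= addnS; lia.
have Hc' : charge (u' ++ t') = 0.
  have := congr1 charge E; move: Hc; rewrite !charge_cat !charge_cons /=; lia.
apply: (G_move_front IHn (p := [::]) (u := (Fb, b) :: u')) => /=.
- by move: Hs Hs'; rewrite !size_cat /=; lia.
- by rewrite !charge_cons Hc' /=.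
rewrite !(wcls_cons k); apply: (G_ef_word IHn) => //.
exact: leq_trans (eq_leq Hs') Hs.
Qed.

(** * Charge grading and the kernel of h(0) *)

Section ChargeProjection.
Variable g : int -> F.

Lemma charge_relator u t x a y b :
  lext (fun w => g (charge w) *: wcls F w) (relator F u t x a y b) = 0.
Proof.
rewrite lext_relator; set c := charge (u ++ (x, a) :: (y, b) :: t).
have -> : charge (u ++ (y, b) :: (x, a) :: t) = c.
  by rewrite /c !charge_cat !charge_cons; lia.
rewrite big_seq (eq_bigr (fun cz => g c *: (cz.1 *:
  wcls F (u ++ (cz.2, (a + b).+1) :: t)))) => [|cz Hcz].
  rewrite -big_seq -scaler_sumr -!scalerBr.
  by have := wcls_relator F u t x a y b; rewrite lext_relator => ->; apply: scaler0.
rewrite [charge _](_ : _ = c); first by rewrite !scalerA mulrC.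
by rewrite /c !charge_cat !charge_cons (br_charge Hcz); lia.
Qed.

Definition charge_scale : weyl -> weyl := factor charge_relator.
End ChargeProjection.

Lemma opH0_w w : op Hb 0 (wcls F w) = (2%:R * (charge w)%:~R) *: wcls F w.
Proof.
elim: w => [|[x a] w IH].
  by rewrite /charge big_nil mulr0 scale0r op_vacuum.
rewrite (wcls_cons k) op_comm IH opZ add0r charge_cons rmorphD /=.
have -> : central k Hb x 0 (- a.+1%:Z) = 0.
  by rewrite /central add0r oppr_eq0.
rewrite scale0r addr0.
case: x; rewrite /= ?big_cons ?big_nil ?addr0 ?add0r ?mulr0z ?mulrN1z ?mulr1z /=.
all: by lmod F.
Qed.

Lemma charge_intr_neq0 (c : int) : c != 0 -> c%:~R != 0 :> F.
Proof.
case: c => [[|n]|n] // _; first exact: char0.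
by rewrite NegzE mulrNz oppr_eq0; apply: char0.
Qed.

(** A representative of [v] may contain words of any charge. Inverting [h(0)] on nonzero charges
    shows that these words sum to zero in the quotient, so [v] equals its part of charge 0. *)
Lemma commutant_G v : commutant k v -> G v.
Proof.
move=> /(_ 0%N); have [u ->] := cls_surj v; rewrite cls_lext => H0.
pose g (c : int) : F := if c == 0 then 0 else (2%:R * c%:~R)^-1.
have : charge_scale g (op Hb 0 (lext (wcls F) u)) = 0.
  by rewrite H0 /charge_scale linear0.
have -> : charge_scale g (op Hb 0 (lext (wcls F) u)) =
    lext (fun w => (if charge w == 0 then 0 else 1) *: wcls F w) u.
  elim: u {H0} => [|[c w] u IH]; first by rewrite !lext_nil op0 /charge_scale linear0.
  rewrite !lext_cons opD opZ /= opH0_w /charge_scale linearD !linearZ /= -/(charge_scale g _).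
  have <- : 2%:R * (charge w)%:~R * g (charge w) = if charge w == 0 then 0 else 1.
    rewrite /g; case: eqP => [->|/eqP Hw]; first by rewrite mulr0.
    by rewrite mulfV // mulf_neq0 // charge_intr_neq0.
  by rewrite -IH /charge_scale factor_w; lmod F.
move=> H; rewrite -[lext _ _]subr0 -H.
elim: u {H H0} => [|[c w] u IH]; first by rewrite !lext_nil subr0.
rewrite !lext_cons opprD addrACA; apply: GD => //=.
rewrite -scalerBr; apply: GZ; case: eqP => [/G_charge0|_]; first by rewrite scale0r subr0.
by rewrite scale1r subrr.
Qed.

Lemma commutant_N v : commutant k v -> N v.
Proof.
move=> Hv; apply: (hspan_commutant N_vac N_D N_Z N_com char0 k_neq0) => //.
exact: commutant_G.
Qed.

End Generation.

Theorem theorem3p1 (F : fieldType) (hF : [pchar F] =i pred0) (k : nat)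
    (hk : (2 <= k)%N) :
  (forall v : vec F, N0 (k%:R : F) v <->
     generated (k%:R : F) [:: omega (k%:R : F); W3 (k%:R : F)] v) /\
  (forall W4 W5 : vec F, N0 (k%:R : F) W4 -> N0 (k%:R : F) W5 ->
     forall v : vec F, N0 (k%:R : F) v <->
       generated (k%:R : F) [:: omega (k%:R : F); W3 (k%:R : F); W4; W5] v).
Proof.
have nat_neq0 n : n.+1%:R != 0 :> F by rewrite ((pcharf0P F).1 hF).
have k_neq0 : k%:R != 0 :> F by case: (k) hk.
set K : F := k%:R; set S := [:: omega K; W3 K].
have N0S s : s \in S -> N0 K s.
  rewrite !inE => /orP [] /eqP ->; apply/N0_cls.
    exact: omega_commutant.
  exact: W3_commutant.
pose N (x : weyl F) := exists2 u, cls u = x & generated K S u.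
have [GV GD GZ GM GE] := generated_vsubalg K S.
(* [generated] is a property of representatives and [N] of classes; closure under [veq] allows the
   return at the end. *)
have N_gen s : s \in S -> N (cls s) by move=> Hs; exists s => // P _; apply.
have N0_generated v : N0 K v -> generated K S v.
  move/N0_cls/(@commutant_N _ K N) => [].
  - by exists (vac F).
  - by move=> _ _ [u <- Hu] [w <- Hw]; exists (u ++ w); rewrite ?cls_cat //; apply: GD.
  - by move=> c _ [u <- Hu]; exists (scalev c u); rewrite ?cls_scale //; apply: GZ.
  - move=> _ _ n [u <- Hu] [w <- Hw]; exists (nprod K u n w); last exact: GM.
    exact: cls_nprod.
  - move=> _ [u <- Hu]; apply/N0_cls.
    exact: (generated_sub (N0_vsubalg K) N0S Hu).
  - exact: nat_neq0.
  - by apply: N_gen; rewrite inE eqxx.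
  - by apply: N_gen; rewrite !inE eqxx orbT.
  - exact: k_neq0.
  (* [k + 2] and [k(a+2) + a + 3] are images of positive integers, hence nonzero in characteristic
     0. *)
  - by rewrite /K -natrD addn2.
  - by move=> a; rewrite /K -natrM -natrD addnS.
  by move=> u /clsP E Hu; apply: GE E Hu.
(* Further generators taken from N_0 neither leave the vertex subalgebra N_0 nor shrink what is
   generated, so the second part follows from the first. *)
split=> [v|W4 W5 H4 H5 v]; split.
- exact: N0_generated.
- exact: (generated_sub (N0_vsubalg K) N0S).
- move=> /N0_generated Hv P HP HS; apply: Hv => // s Hs; apply: HS.
  by move: Hs; rewrite !inE => /orP [] ->; rewrite ?orbT.
apply: (generated_sub (N0_vsubalg K)) => s; rewrite !inE.
case/or4P => /eqP -> //; apply: N0S; by rewrite !inE eqxx ?orbT.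
Qed.
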